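(* Let $\alpha\in(0,4)$ and $\beta\ge 0$. Let $\mathbf{Z}=\mathbf{Z}_n=(Z_{it})_{i=1,\ldots,p;\,t=1,\ldots,n}$ be $p\times n$ random matrices with iid real entries with generic element $Z$ such that: (i) there are constants $p_+,p_-\ge 0$ with $p_++p_-=1$ and a slowly varying function $L$ with $\mathbb{P}(Z>x)\sim p_+L(x)x^{-\alpha}$ and $\mathbb{P}(Z<-x)\sim p_-L(x)x^{-\alpha}$ as $x\to\infty$; (ii) $\mathbb{E}[Z]=0$ if $\alpha\ge 2$; (iii) $p=p_n=n^\beta\ell(n)$, $n\ge1$, is an integer sequence where $\ell$ is slowly varying, and if $\beta=0$ also $\ell(n)\to\infty$. Then the following hold. (1) If $\beta\in[0,1]$, then $a_{np}^{-2}\,\|\mathbf{Z}\mathbf{Z}'-\operatorname{diag}(\mathbf{Z}\mathbf{Z}')\|_2\to 0$ in probability as $n\to\infty$. (2) If $\beta\ge1$, then $a_{np}^{-2}\,\|\mathbf{Z}'\mathbf{Z}-\operatorname{diag}(\mathbf{Z}'\mathbf{Z})\|_2\to 0$ in probability as $n\to\infty$.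
   Context: $(a_k)_{k\ge1}$ is a sequence with $\mathbb{P}(|Z|>a_k)\sim k^{-1}$ as $k\to\infty$; $a_{np}$ is its term with index $np=n\,p_n$. $\|\cdot\|_2$ is the spectral norm (largest singular value), and $\operatorname{diag}(\mathbf{A})$ is the diagonal matrix with the same diagonal as the square matrix $\mathbf{A}$. *)

(* Defs.v *)
From HB Require Import structures.
From mathcomp Require Import all_boot all_order all_algebra.
From mathcomp Require Import all_classical all_reals all_analysis.
Import Order.TTheory GRing.Theory Num.Theory.
Import numFieldNormedType.Exports.

Set Implicit Arguments.
Unset Strict Implicit.
Unset Printing Implicit Defensive.

Local Open Scope classical_set_scope.
Local Open Scope ring_scope.

(* Karamata's definition: positivity and measurability are only required on
   some neighbourhood [x0, +oo[ of infinity. *)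
Definition slowly_varying (R : realType) (L : R -> R) : Prop :=
  (exists x0 : R, (forall x, x0 <= x -> 0 < L x) /\
                  measurable_fun `[x0, +oo[%classic L) /\
  (forall c : R, 0 < c -> L (c * x) / L x @[x --> +oo] --> (1 : R)).

(* The equality of laws is only asked on measurable sets: equality of the
   [distribution]s would also constrain them on non-measurable sets. *)
Definition same_law (R : realType) (d d' : measure_display)
    (T : measurableType d) (P : probability T R)
    (T' : measurableType d') (P' : probability T' R)
    (X : T -> R) (Y : T' -> R) : Prop :=
  forall B : set R, measurable B -> P (X @^-1` B) = P' (Y @^-1` B).

Definition mutually_independent (R : realType) (d : measure_display)
    (T : measurableType d) (P : probability T R) (I : finType)
    (X : I -> T -> R) : Prop :=
  forall (J : {set I}) (B : I -> set R), (forall i, measurable (B i)) ->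
    P (\bigcap_(i in [set i | i \in J]) (X i @^-1` B i)) =
    (\prod_(i in J) P (X i @^-1` B i))%E.

Definition cvg_in_probability (R : realType) (d : measure_display)
    (T : measurableType d) (P : probability T R) (X : nat -> T -> R)
    (Y : T -> R) : Prop :=
  forall e : R, 0 < e ->
    P [set w | e < `|X n w - Y w|] @[n --> \oo] --> (0 : \bar R).

(* P(Z > x) ~ q L(x) x^-alpha and P(Z < -x) ~ q' L(x) x^-alpha as x -> +oo.
   Since q or q' may be 0, f ~ q g is read as f / g -> q, i.e. f = o(g)
   when q = 0. *)
Definition tail_balance (R : realType) (d : measure_display)
    (T : measurableType d) (P : probability T R) (Z : T -> R)
    (alpha q q' : R) (L : R -> R) : Prop :=
  (fine (P [set w | x < Z w]) / (L x * x `^ (- alpha))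
     @[x --> +oo] --> q) /\
  (fine (P [set w | Z w < - x]) / (L x * x `^ (- alpha))
     @[x --> +oo] --> q').

(* P(|Z| > a_k) ~ 1 / k as k -> oo. *)
Definition normalizing_sequence (R : realType) (d : measure_display)
    (T : measurableType d) (P : probability T R) (Z : T -> R)
    (a : nat -> R) : Prop :=
  fine (P [set w | a k < `|Z w|]) / k%:R^-1 @[k --> \oo] --> (1 : R).

Definition singular_values (R : realType) (m n : nat) (A : 'M[R]_(m, n)) :
    set R :=
  [set s | 0 <= s /\ eigenvalue (A^T *m A) (s ^+ 2)].

(* [singular_values A] is finite, and nonempty as soon as n > 0, so the
   supremum is a maximum; it is 0 by convention when n = 0. *)
Definition spectral_norm (R : realType) (m n : nat) (A : 'M[R]_(m, n)) : R :=
  sup (singular_values A).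

Definition diag_part (R : realType) (n : nat) (A : 'M[R]_n) : 'M[R]_n :=
  diag_mx (\row_i A i i).

Definition sample_mx (R : realType) (T : Type) (p n : nat)
    (Z : 'I_p -> 'I_n -> T -> R) (w : T) : 'M[R]_(p, n) :=
  \matrix_(i < p, t < n) Z i t w.

(* Main.v *)
Require Import Defs.
From HB Require Import structures.
From mathcomp Require Import all_boot all_order all_algebra.
From mathcomp Require Import all_classical all_reals all_analysis.
From mathcomp Require Import measurable_realfun.
From mathcomp Require Import ring lra zify.
Import Order.TTheory GRing.Theory Num.Theory.
Import numFieldNormedType.Exports.

Set Implicit Arguments.
Unset Strict Implicit.
Unset Printing Implicit Defensive.

Local Open Scope classical_set_scope.
Local Open Scope ring_scope.

(** Write x = n p, let M be the off-diagonal part of Z Z', and fix s > alpha close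
    to alpha. The tails of |Z| decay like x^-alpha up to factors smaller than any
    power, so a_x is at least x^(1/s), and it is enough to show that ||M|| is small
    compared with x^(2/s). Only two features of the shape of the array are used: its
    size x tends to infinity, and it has at most x^(1/2 + delta) rows. For beta <= 1
    this holds for Z and for beta >= 1 it holds for Z', because a slowly varying
    function lies between n^-delta and n^delta ([sv_power_bounds]); the second
    assertion is thus the first one for the transposed array.

    If alpha <= 2, truncate the entries slightly above x^(1/alpha): with high
    probability no entry is affected, and the second moment of the Frobenius norm of
    the truncated M is already small enough ([norm_small_frobenius]).

    If 2 < alpha < 4, the Frobenius norm is of order at least m sqrt n for m rows and
    n columns, which is too much for alpha near 4. Split Z = A + B, where A consists
    of the entries of size at most K = x^(1/4), recentred, and expand M into four
    pieces. The three pieces containing B are still controlled by their Frobenius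
    norms: E B^2 is about K^(2 - alpha), which makes the squared norm of order
    x^(2 - alpha/4), and

        4/alpha - (2 - alpha/4) = (4 - alpha)^2 / (4 alpha) > 0.

    The piece built on A has bounded variance and bounded entries, and its operator
    norm is close to x^(1/2), which is smaller than x^(2/alpha). This is the method of
    moments: ||M||^(2q) is at most the trace of M^(2q), a sum over closed walks that
    alternate between rows and columns. Since the diagonal of Z Z' has been removed, a
    walk never returns at once through the same entry, so it meets each of its columns
    through at least two different entries; since the entries are centred, a walk
    contributes only if it meets each entry at least twice. Counting vertices against
    edges then gives x^((1/2 + delta) 2q) up to a constant and a factor m
    ([mean_frob2_off_gramX]), and a large fixed q makes this factor harmless
    ([norm_small_split]). *)

(** * Bounded measurable functions *)

Lemma measurable_le_set {d} {T : measurableType d} {R : realType}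
    (f g : T -> R) : measurable_fun setT f -> measurable_fun setT g ->
  measurable [set x | f x <= g x].
Proof.
move=> mf mg; rewrite -[X in measurable X]setTI.
exact: (@measurable_fun_le _ _ _ setT f g).
Qed.

Lemma measurable_lt_set {d} {T : measurableType d} {R : realType}
    (f g : T -> R) : measurable_fun setT f -> measurable_fun setT g ->
  measurable [set x | f x < g x].
Proof.
move=> mf mg; rewrite (_ : [set x | _] = ~` [set x | g x <= f x]).
  by apply: measurableC; exact: measurable_le_set.
by apply/seteqP; split => x /=; rewrite ltNge => /negP.
Qed.

Lemma indic_bool {T : Type} {R : realType} (b : T -> bool) (x : T) :
  \1_[set y | b y] x = (b x)%:R :> R.
Proof.
rewrite indicE; suff -> : (x \in [set y | b y]) = b x by [].
by apply/idP/idP; rewrite inE.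
Qed.

Section BoundedMeasurable.
Context {d : measure_display} {T : measurableType d} {R : realType}.
Implicit Types f g : T -> R.

Definition bounded_mfun f :=
  measurable_fun setT f /\ exists M : R, forall x, `|f x| <= M.

Lemma bmf_cst (c : R) : bounded_mfun (fun=> c).
Proof. by split; [exact: measurable_cst | exists `|c|]. Qed.

Lemma bmfD f g : bounded_mfun f -> bounded_mfun g ->
  bounded_mfun (fun x => f x + g x).
Proof.
move=> [mf [M fM]] [mg [N gN]]; split; first exact: measurable_funD.
exists (M + N) => x; apply: le_trans (ler_normD _ _) _; exact: lerD.
Qed.

Lemma bmfM f g : bounded_mfun f -> bounded_mfun g ->
  bounded_mfun (fun x => f x * g x).
Proof.
move=> [mf [M fM]] [mg [N gN]]; split; first exact: measurable_funM.
by exists (M * N) => x; rewrite normrM; exact: ler_pM.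
Qed.

Lemma bmfZ c f : bounded_mfun f -> bounded_mfun (fun x => c * f x).
Proof. by move=> bf; apply: bmfM => //; exact: bmf_cst. Qed.

Lemma bmfN f : bounded_mfun f -> bounded_mfun (fun x => - f x).
Proof.
move=> [mf [M fM]]; split; first exact: measurableT_comp.
by exists M => x; rewrite normrN.
Qed.

Lemma bmfB f g : bounded_mfun f -> bounded_mfun g ->
  bounded_mfun (fun x => f x - g x).
Proof. by move=> bf bg; apply: bmfD => //; exact: bmfN. Qed.

Lemma bmf_norm f : bounded_mfun f -> bounded_mfun (fun x => `|f x|).
Proof.
move=> [mf [M fM]]; split; first exact: measurableT_comp.
by exists M => x; rewrite normr_id.
Qed.

Lemma bmfX f n : bounded_mfun f -> bounded_mfun (fun x => f x ^+ n).
Proof.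
move=> bf; elim: n => [|n IH].
  by under eq_fun do rewrite expr0; exact: bmf_cst.
by under eq_fun do rewrite exprS; exact: bmfM.
Qed.

Lemma bmf_sum (I : Type) (s : seq I) (Q : pred I) (f : I -> T -> R) :
  (forall i, bounded_mfun (f i)) -> bounded_mfun (fun x => \sum_(i <- s | Q i) f i x).
Proof.
move=> bf; elim: s => [|i s IH].
  by under eq_fun do rewrite big_nil; exact: bmf_cst.
under eq_fun do rewrite big_cons.
by case: (Q i) => //; exact: bmfD.
Qed.

Lemma bmf_prod (I : Type) (s : seq I) (Q : pred I) (f : I -> T -> R) :
  (forall i, bounded_mfun (f i)) -> bounded_mfun (fun x => \prod_(i <- s | Q i) f i x).
Proof.
move=> bf; elim: s => [|i s IH].
  by under eq_fun do rewrite big_nil; exact: bmf_cst.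
under eq_fun do rewrite big_cons.
by case: (Q i) => //; exact: bmfM.
Qed.

Lemma bmf_indic (A : set T) : measurable A -> bounded_mfun (\1_A : T -> R).
Proof.
move=> mA; split; first exact: measurable_indic.
by exists 1 => x; rewrite indicE; case: (_ \in _); rewrite ?normr1 ?normr0.
Qed.

(** Induction on bounded measurable functions by uniform limits of step functions.
    Identities between means pass to uniform limits by a mere triangle inequality, so
    that equality of laws and independence, which are given on events, extend to
    bounded functions without any limit theorem for integrals. *)
Lemma bmf_ind (Q : (T -> R) -> Prop) :
  (forall A, measurable A -> Q (\1_A : T -> R)) ->
  (forall c f g, bounded_mfun f -> bounded_mfun g -> Q f -> Q g ->
     Q (fun x => c * f x + g x)) ->
  (forall f, bounded_mfun f ->
     (forall e : R, 0 < e -> exists2 g, bounded_mfun g /\ Q g &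
        forall x, `|f x - g x| <= e) -> Q f) ->
  forall f, bounded_mfun f -> Q f.
Proof.
move=> Qi Ql Qu.
have Q1 : Q (fun=> 1).
  have := Qi _ measurableT; congr Q; apply/funext => x.
  by rewrite indicE in_setT.
have Q0 : Q (fun=> 0).
  have := Ql (-1) _ _ (bmf_cst 1) (bmf_cst 1) Q1 Q1; congr Q.
  by apply/funext => x; rewrite mulr1 addNr.
have Qsum (s : seq nat) (F : nat -> T -> R) c :
    (forall i, bounded_mfun (F i)) -> (forall i, Q (F i)) ->
    Q (fun x => \sum_(i <- s) c * F i x).
  move=> bF QF; elim: s => [|i s IH].
    by under eq_fun do rewrite big_nil.
  under eq_fun do rewrite big_cons.
  by apply: Ql => //; apply: bmf_sum => j; exact: bmfZ.
(* On [0, 1] the function is within 1 / n of the average of the indicators of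
   its super-level sets at heights k / n. *)
have Q01 f : bounded_mfun f -> (forall x, 0 <= f x <= 1) -> Q f.
  move=> bf f01; apply: Qu => // e e0.
  set n := (Num.truncn e^-1).+1.
  have n0 : 0 < n%:R :> R by rewrite ltr0n.
  have ne : n%:R^-1 <= e.
    rewrite invf_ple ?posrE//; apply/ltW.
    by have /andP[] := truncn_itv (ltW (eqbRL (invr_gt0 e) e0)).
  have mA k : measurable [set x | k.+1%:R <= n%:R * f x].
    apply: measurable_le_set; first exact: measurable_cst.
    by apply: measurable_funM => //; case: bf.
  exists (fun x => \sum_(k <- iota 0 n)
      n%:R^-1 * \1_([set x | k.+1%:R <= n%:R * f x]) x).
    split.
      by apply: bmf_sum => k; apply: bmfZ; exact: bmf_indic.
    by apply: Qsum => k; [exact: bmf_indic | exact: Qi].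
  move=> x; apply: le_trans ne.
  rewrite -mulr_sumr.
  have nf0 : 0 <= n%:R * f x by have /andP[f0 _] := f01 x; rewrite mulr_ge0.
  have -> : \sum_(k <- iota 0 n) \1_([set x | k.+1%:R <= n%:R * f x]) x =
      (Num.truncn (n%:R * f x))%:R :> R.
    transitivity ((\sum_(0 <= k < n) (k < Num.truncn (n%:R * f x))%N)%:R : R).
      rewrite natr_sum /index_iota subn0; apply: eq_bigr => k _.
      by rewrite indic_bool truncn_gt_nat.
    congr (_%:R).
    have tn : (Num.truncn (n%:R * f x) <= n)%N.
      have /andP[_ f1] := f01 x.
      rewrite -(ler_nat R); apply: le_trans (_ : n%:R * f x <= _).
        by rewrite truncn_le.
      by rewrite ler_piMr// ltW.
    rewrite (@big_cat_nat _ _ _ (Num.truncn (n%:R * f x)))//=.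
    rewrite (eq_big_nat _ _ (F2 := fun=> 1%N)); last first.
      by move=> i /andP[_ ->].
    rewrite sum_nat_const_nat muln1 subn0 big_nat big1 ?addn0// => i.
    by case/andP=> ti _; rewrite ltnNge ti.
  have /andP[t1 t2] := truncn_itv nf0.
  rewrite -[X in X - _](mulKf (lt0r_neq0 n0)) -mulrBr normrM ger0_norm ?invr_ge0 ?(ltW n0)//.
  rewrite ler_piMr ?invr_ge0 ?(ltW n0)// ger0_norm ?subr_ge0//.
  by rewrite lerBlDr addrC natr1 ltW.
move=> f bf; have [mf [M fM]] := bf.
have [M0 fM'] : exists2 N : R, 0 < N & forall x, `|f x| <= N.
  exists (`|M| + 1) => [|x]; first by rewrite ltr_wpDl.
  by apply: le_trans (fM x) _; rewrite ler_wpDr// ler_norm.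
move=> H.
have bg : bounded_mfun (fun x => (M0 + M0)^-1 * (f x + M0)).
  by apply: bmfZ; apply: bmfD => //; exact: bmf_cst.
have Qg : Q (fun x => (M0 + M0)^-1 * (f x + M0)).
  apply: Q01 => // x; have := H x; rewrite ler_norml => /andP[a1 a2].
  have M2 : 0 < M0 + M0 by rewrite addr_gt0.
  rewrite ler_pdivrMl// mulr1 lerD2r a2 andbT.
  by rewrite mulr_ge0 ?invr_ge0 ?(ltW M2)// -lerBlDr sub0r.
have := Ql (- M0) _ _ (bmf_cst 1) bg Q1 Qg.
set h := (fun x => _ + _) => Qh.
have bh : bounded_mfun h by apply: bmfD => //; exact: bmf_cst.
have Qh' := Ql (- M0) _ _ (bmf_cst 1) (bmf_cst 0) Q1 Q0.
have bh' : bounded_mfun (fun x => - M0 * 1 + 0 : R) by exact: bmf_cst.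
have := Ql (M0 + M0) _ _ bg bh' Qg Qh'.
congr Q; apply/funext => x.
by rewrite mulrA divff ?gt_eqF ?addr_gt0// mul1r; ring.
Qed.

End BoundedMeasurable.

(** * Means, equal laws and independence *)

Section Mean.
Context {d : measure_display} {T : measurableType d} {R : realType}.
Variable P : probability T R.
Implicit Types f g : T -> R.

Definition mean (f : T -> R) : R := \int[P]_w f w.

Lemma bmf_integrable f : bounded_mfun f -> P.-integrable setT (EFin \o f).
Proof.
move=> [mf [M fM]]; apply: measurable_bounded_integrable => //.
  exact: le_lt_trans (probability_le1 P measurableT) (ltry _).
exists M; split; first exact: num_real.
by move=> y My x _ /=; apply: le_trans (fM x) _; exact: ltW.
Qed.

Lemma meanD f g : bounded_mfun f -> bounded_mfun g ->
  mean (fun w => f w + g w) = mean f + mean g.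
Proof. by move=> bf bg; rewrite /mean RintegralD//; exact: bmf_integrable. Qed.

Lemma meanZ c f : bounded_mfun f -> mean (fun w => c * f w) = c * mean f.
Proof. by move=> bf; rewrite /mean RintegralZl//; exact: bmf_integrable. Qed.

Lemma mean_cst c : mean (fun=> c) = c.
Proof.
rewrite /mean Rintegral_cst//; transitivity (c * fine (1%E : \bar R)).
  by congr (c * fine _); exact: probability_setT.
by rewrite mulr1.
Qed.

Lemma meanB f g : bounded_mfun f -> bounded_mfun g ->
  mean (fun w => f w - g w) = mean f - mean g.
Proof. by move=> bf bg; rewrite /mean RintegralB//; exact: bmf_integrable. Qed.

Lemma mean_sum (I : Type) (s : seq I) (Q : pred I) (f : I -> T -> R) :
  (forall i, bounded_mfun (f i)) ->
  mean (fun w => \sum_(i <- s | Q i) f i w) = \sum_(i <- s | Q i) mean (f i).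
Proof.
move=> bf; elim: s => [|i s IH].
  by under eq_fun do rewrite big_nil; rewrite mean_cst big_nil.
under eq_fun do rewrite big_cons; rewrite big_cons.
by case: (Q i) => //; rewrite meanD ?IH//; exact: bmf_sum.
Qed.

Lemma mean_le f g : bounded_mfun f -> bounded_mfun g ->
  (forall w, f w <= g w) -> mean f <= mean g.
Proof.
by move=> bf bg fg; apply: le_Rintegral => //; exact: bmf_integrable.
Qed.

Lemma mean_ge0 f : (forall w, 0 <= f w) -> 0 <= mean f.
Proof. by move=> f0; apply: Rintegral_ge0. Qed.

Lemma mean_norm f : bounded_mfun f -> `|mean f| <= mean (fun w => `|f w|).
Proof. by move=> bf; apply: le_normr_Rintegral => //; exact: bmf_integrable. Qed.

Lemma mean_indic A : measurable A -> mean (\1_A) = fine (P A).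
Proof. by move=> mA; rewrite /mean /Rintegral integral_indic// setIT. Qed.

Lemma mean_dist f g (e : R) : bounded_mfun f -> bounded_mfun g ->
  (forall w, `|f w - g w| <= e) -> `|mean f - mean g| <= e.
Proof.
move=> bf bg fg; rewrite -meanB//; apply: le_trans (mean_norm _) _; first exact: bmfB.
rewrite -[leRHS]mean_cst; apply: mean_le => //; last exact: bmf_cst.
by apply: bmf_norm; exact: bmfB.
Qed.

Lemma bmf_comp (g : R -> R) (X : T -> R) : measurable_fun setT X ->
  bounded_mfun g -> bounded_mfun (fun w => g (X w)).
Proof.
move=> mX [mg [M gM]]; split; last by exists M => w; exact: gM.
exact: (measurableT_comp mg mX).
Qed.

Lemma mean_same_law (X Y : T -> R) (g : R -> R) :
  measurable_fun setT X -> measurable_fun setT Y -> same_law P P X Y ->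
  bounded_mfun g -> mean (fun w => g (X w)) = mean (fun w => g (Y w)).
Proof.
move=> mX mY XY; move: g; apply: bmf_ind => [A mA|c f g bf bg Ef Eg|f bf H].
- transitivity (fine (P (X @^-1` A))).
    rewrite -mean_indic; last by rewrite -[X in measurable X]setTI; exact: mX.
    by congr mean; apply/funext => w; rewrite !indicE.
  rewrite XY// -mean_indic; last by rewrite -[X in measurable X]setTI; exact: mY.
  by congr mean; apply/funext => w; rewrite !indicE.
- have bfX Z : measurable_fun setT Z -> bounded_mfun (fun w : T => f (Z w)).
    by move=> mZ; exact: bmf_comp.
  have bgX Z : measurable_fun setT Z -> bounded_mfun (fun w : T => g (Z w)).
    by move=> mZ; exact: bmf_comp.
  by rewrite !meanD ?meanZ ?Ef ?Eg//; try apply: bmfZ; auto.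
- apply/eqP; rewrite -subr_eq0 -normr_le0; apply/ler_addgt0Pl => e e0.
  rewrite addr0; have [g [bg Eg] fg] := H (e / 2) (divr_gt0 e0 (ltr0n _ 2)).
  rewrite (_ : _ - _ = (mean (fun w => f (X w)) - mean (fun w => g (X w))) +
     (mean (fun w => g (Y w)) - mean (fun w => f (Y w)))); last by rewrite Eg; ring.
  apply: le_trans (ler_normD _ _) _; rewrite [leRHS]splitr; apply: lerD.
    by apply: mean_dist => //; exact: bmf_comp.
  by apply: mean_dist => [||w]; [exact: bmf_comp..| rewrite distrC].
Qed.

Section Product.
Context {I : finType}.
Variable X : I -> T -> R.
Hypothesis mX : forall i, measurable_fun setT (X i).
Hypothesis indepX : mutually_independent P X.

Lemma mean_prod_indic (B : I -> set R) : (forall i, measurable (B i)) ->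
  mean (fun w => \prod_i \1_(B i) (X i w)) =
  \prod_i mean (fun w => \1_(B i) (X i w)).
Proof.
move=> mB.
have mXB i : measurable (X i @^-1` B i) by rewrite -[X in measurable X]setTI; exact: mX.
transitivity (fine (P (\bigcap_(i in [set i | i \in [set: I]%SET]) (X i @^-1` B i)))).
  rewrite -mean_indic; last by apply: fin_bigcap_measurable.
  congr mean; apply/funext => w; rewrite indicE.
  have [H|H] := boolP (w \in _).
    rewrite big1// => i _; rewrite indicE mem_set//.
    by move: H; rewrite inE => /(_ i); apply; rewrite /= inE.
  have [i Hi] : exists i, ~ B i (X i w).
    apply: contrapT => /forallNP H'; move/negP: H; apply; rewrite inE => i _.
    exact: contrapT (H' i).
  by rewrite (bigD1 i)//= indicE memNset ?mul0r.
rewrite indepX//.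
rewrite [X in fine X](eq_bigl xpredT); last by move=> i; rewrite finset.in_setT.
rewrite (eq_bigr (fun i => (mean (fun w => \1_(B i) (X i w)))%:E)); last first.
  move=> i _; rewrite [in RHS](_ : (fun w => _) = \1_(X i @^-1` B i)).
    by rewrite mean_indic// fineK// fin_num_measure.
  by apply/funext => w; rewrite !indicE.
by rewrite prodEFin.
Qed.

Lemma mean_prod_indep (f : I -> R -> R) : (forall i, bounded_mfun (f i)) ->
  mean (fun w => \prod_i f i (X i w)) = \prod_i mean (fun w => f i (X i w)).
Proof.
move=> bf.
(* Indicators are replaced by bounded functions one coordinate at a time. *)
suff H (s : seq I) : forall f : I -> R -> R, (forall i, bounded_mfun (f i)) ->
    (forall i, i \notin s -> exists2 B, measurable B & f i = \1_B) ->
    mean (fun w => \prod_i f i (X i w)) = \prod_i mean (fun w => f i (X i w)).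
  by apply: (H (enum I)) => // i; rewrite mem_enum.
move=> {f bf}; elim: s => [|j s IH] f bf fi.
  have /choice[B BP] : forall i, exists B, measurable B /\ f i = \1_B.
    by move=> i; have [//|B] := fi i; exists B.
  have -> : f = fun i => \1_(B i) by apply/funext => i; have [] := BP i.
  by apply: mean_prod_indic => i; have [] := BP i.
set G := fun w => \prod_(i | i != j) f i (X i w).
set c := \prod_(i | i != j) mean (fun w => f i (X i w)).
have bG : bounded_mfun G by apply: bmf_prod => i; exact: bmf_comp.
suff H (g : R -> R) : bounded_mfun g ->
    mean (fun w => g (X j w) * G w) = mean (fun w => g (X j w)) * c.
  rewrite [RHS](bigD1 j)//= -H//; congr mean; apply/funext => w.
  by rewrite (bigD1 j).
have bX (g' : R -> R) : bounded_mfun g' -> bounded_mfun (fun w => g' (X j w)).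
  by move=> ?; exact: bmf_comp.
have bXG (g' : R -> R) : bounded_mfun g' -> bounded_mfun (fun w => g' (X j w) * G w).
  by move=> ?; apply: bmfM => //; exact: bX.
move: g; apply: bmf_ind => [A mA|a g h bg bh Eg Eh|g bg Hg].
- pose f' i := if i == j then \1_A : R -> R else f i.
  have f'j : f' j = \1_A by rewrite /f' eqxx.
  have f'i i : i != j -> f' i = f i by move=> /negPf ij; rewrite /f' ij.
  rewrite [c](eq_bigr (fun i => mean (fun w => f' i (X i w)))); last first.
    by move=> i ij; rewrite f'i.
  transitivity (\prod_i mean (fun w => f' i (X i w))); last first.
    by rewrite (bigD1 j)//= f'j.
  rewrite -IH -?f'j.
  + congr mean; apply/funext => w; rewrite [RHS](bigD1 j)//=; congr (_ * _).
    by apply: eq_bigr => i ij; rewrite f'i.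
  + by move=> i; rewrite /f'; case: eqP => // _; exact: bmf_indic.
  + move=> i si; rewrite /f'; case: eqP => [_|ij]; first by exists A.
    by apply: fi; rewrite inE negb_or si andbT; apply/eqP.
- transitivity (mean (fun w => a * (g (X j w) * G w) + h (X j w) * G w)).
    by congr mean; apply/funext => w; rewrite mulrDl mulrA.
  rewrite (meanD (bmfZ a (bXG _ bg)) (bXG _ bh)) (meanZ a (bXG _ bg)) Eg Eh.
  by rewrite (meanD (bmfZ a (bX _ bg)) (bX _ bh)) (meanZ a (bX _ bg)) mulrDl mulrA.
- apply/eqP; rewrite -subr_eq0 -normr_le0; apply/ler_addgt0Pl => e e0.
  have [M M0 GM] : exists2 M, 0 < M & forall w, `|G w| <= M.
    have [_ [M GM]] := bG; exists (`|M| + 1); first by rewrite ltr_wpDl.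
    by move=> w; apply: le_trans (GM w) _; rewrite ler_wpDr// ler_norm.
  have D0 : 0 < M + `|c| by rewrite ltr_pwDl.
  rewrite addr0; have [h [bh Eh] gh] := Hg (e / (M + `|c|)) (divr_gt0 e0 D0).
  rewrite (_ : _ - _ =
     (mean (fun w => g (X j w) * G w) - mean (fun w => h (X j w) * G w)) +
     (mean (fun w => h (X j w)) - mean (fun w => g (X j w))) * c); last first.
    by rewrite Eh; ring.
  rewrite -[leRHS](divfK (lt0r_neq0 D0)) mulrDr.
  apply: le_trans (ler_normD _ _) _; apply: lerD.
    apply: mean_dist => [||w]; [exact: bXG..|].
    by rewrite -mulrBl normrM; exact: ler_pM.
  rewrite normrM ler_wpM2r//; apply: mean_dist => [||w]; [exact: bX..|].
  by rewrite distrC.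
Qed.

End Product.
End Mean.

(** * Arrays of independent, identically distributed entries *)

Section Array.
Context {d : measure_display} {T : measurableType d} {R : realType}.
Variable P : probability T R.
Variable Z0 : T -> R.
Local Notation E := (mean P).

(** Independence and equality of laws in the form of a product formula. The nested
    products make the notion visibly invariant under transposition: exchange them. *)
Definition iid_array (m n : nat) (X : 'I_m -> 'I_n -> T -> R) : Prop :=
  (forall i t, measurable_fun setT (X i t)) /\
  forall f : 'I_m -> 'I_n -> R -> R, (forall i t, bounded_mfun (f i t)) ->
    E (fun w => \prod_i \prod_t f i t (X i t w)) =
    \prod_i \prod_t E (fun w => f i t (Z0 w)).

Lemma iid_array_tr m n (X : 'I_m -> 'I_n -> T -> R) :
  iid_array X -> iid_array (fun t i => X i t).
Proof.
move=> [mX HX]; split=> [i t|f bf]; first exact: mX.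
rewrite exchange_big/= -(HX (fun i t => f t i))//; congr E.
by apply/funext => w; rewrite exchange_big.
Qed.

Lemma iid_array_indep m n (X : 'I_m -> 'I_n -> T -> R) :
  measurable_fun setT Z0 -> (forall i t, measurable_fun setT (X i t)) ->
  (forall i t, same_law P P (X i t) Z0) ->
  mutually_independent P (fun k : 'I_m * 'I_n => X k.1 k.2) -> iid_array X.
Proof.
move=> mZ mX XZ indX; split=> // f bf.
have := mean_prod_indep (fun k => mX k.1 k.2) indX (f := fun k => f k.1 k.2).
rewrite -(pair_big xpredT xpredT (fun i t => E (fun w => f i t (X i t w))))/=.
move=> /(_ (fun k => bf k.1 k.2)) H.
transitivity (\prod_i \prod_t E (fun w => f i t (X i t w))).
  rewrite -H; congr E; apply/funext => w.
  by rewrite (pair_big xpredT xpredT (fun i t => f i t (X i t w))).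
by do 2 (apply: eq_bigr => ? _); exact: mean_same_law.
Qed.

Section Moments.
Context {m n : nat} {X : 'I_m -> 'I_n -> T -> R}.
Hypothesis mZ : measurable_fun setT Z0.
Hypothesis iidX : iid_array X.

Let mX i t : measurable_fun setT (X i t).
Proof. by case: iidX. Qed.

Let mean1 : E (fun=> 1) = 1.
Proof. exact: mean_cst. Qed.

(** The factors of a product may refer to the same entry repeatedly, as they do along
    a walk; grouping them by entry is what independence needs. *)
Lemma mean_prod_seq (A : Type) (L : seq A) (key : A -> 'I_m * 'I_n)
    (g : A -> R -> R) : (forall a, bounded_mfun (g a)) ->
  E (fun w => \prod_(a <- L) g a (X (key a).1 (key a).2 w)) =
  \prod_k E (fun w => \prod_(a <- L | key a == k) g a (Z0 w)).
Proof.
move=> bg; have [_ HX] := iidX.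
pose f i t (z : R) := \prod_(a <- L | key a == (i, t)) g a z.
have bf i t : bounded_mfun (f i t) by exact: bmf_prod.
have := HX f bf; rewrite (pair_big xpredT xpredT (fun i t => E (fun w => f i t (Z0 w))))/=.
rewrite [in RHS](eq_bigr (fun k => E (fun w => \prod_(a <- L | key a == k) g a (Z0 w)))).
  move=> <-; congr E; apply/funext => w.
  rewrite (pair_big xpredT xpredT (fun i t => f i t (X i t w)))/=.
  rewrite (partition_big key xpredT)//=; apply: eq_bigr => -[i t] _.
  by rewrite /f; apply: eq_bigr => a /eqP ->.
by move=> [i t] _.
Qed.

Lemma mean_prod_uniq (A : Type) (L : seq A) (key : A -> 'I_m * 'I_n)
    (g : A -> R -> R) : (forall a, bounded_mfun (g a)) -> uniq (map key L) ->
  E (fun w => \prod_(a <- L) g a (X (key a).1 (key a).2 w)) =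
  \prod_(a <- L) E (fun w => g a (Z0 w)).
Proof.
move=> bg; rewrite mean_prod_seq//; elim: L => [|a L IH] /=.
  by rewrite big_nil big1// => k _; under eq_fun do rewrite big_nil.
move=> /andP[aL uL]; rewrite big_cons -IH// (bigD1 (key a))//=.
rewrite [in RHS](bigD1 (key a))//= mulrA; congr (_ * _).
  have H z : \prod_(j <- L | key j == key a) g j z = 1.
    elim: L aL {IH uL} => [|b L IH] /=; first by rewrite big_nil.
    by rewrite inE negb_or big_cons => /andP[/negPf ab /IH ->]; rewrite eq_sym ab.
  under eq_fun do rewrite big_cons eqxx H mulr1.
  by under [X in _ = _ * E X]eq_fun do rewrite H; rewrite mean1 mulr1.
apply: eq_bigr => k ka; congr E; apply/funext => w.
by rewrite big_cons eq_sym (negPf ka).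
Qed.

(** Expanding the square gives n^2 terms indexed by two columns t and s. Those with
    t = s produce the second moments; in the others the four entries involved are
    distinct, because i <> j, and each contributes a first moment. *)
Lemma mean_sq_offdiag_entry (u v : R -> R) i j : i != j ->
  bounded_mfun u -> bounded_mfun v ->
  E (fun w => (\sum_t u (X i t w) * v (X j t w)) ^+ 2) <=
  n%:R * (E (fun w => u (Z0 w) ^+ 2) * E (fun w => v (Z0 w) ^+ 2)) +
  n%:R ^+ 2 * (E (fun w => u (Z0 w)) ^+ 2 * E (fun w => v (Z0 w)) ^+ 2).
Proof.
move=> ij bu bv.
have buX i' t : bounded_mfun (fun w => u (X i' t w)) by exact: bmf_comp.
have bvX i' t : bounded_mfun (fun w => v (X i' t w)) by exact: bmf_comp.
set u2 := E (fun w => u (Z0 w) ^+ 2); set v2 := E (fun w => v (Z0 w) ^+ 2).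
set u1 := E (fun w => u (Z0 w)); set v1 := E (fun w => v (Z0 w)).
have Ets t s : E (fun w => (u (X i t w) * v (X j t w)) * (u (X i s w) * v (X j s w))) =
    if t == s then u2 * v2 else u1 ^+ 2 * v1 ^+ 2.
  case: eqP => [<-|/eqP ts].
    pose g b (z : R) := if b then u z ^+ 2 else v z ^+ 2.
    have bg b : bounded_mfun (g b) by case: b; exact: bmfX.
    have := @mean_prod_uniq bool [:: true; false] (fun b => if b then (i, t) else (j, t)) g bg.
    rewrite !big_cons !big_nil /= mulr1 => <-.
      by congr E; apply/funext => w; rewrite !big_cons big_nil /= mulr1; ring.
    by rewrite inE xpair_eqE (negPf ij).
  pose g (b : bool * bool) (z : R) := if b.1 then u z else v z.
  have bg b : bounded_mfun (g b) by rewrite /g; case: b.1.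
  pose key (b : bool * bool) := (if b.1 then i else j, if b.2 then t else s).
  have := @mean_prod_uniq _ [:: (true, true); (false, true); (true, false); (false, false)]
    key g bg.
  rewrite !big_cons !big_nil /= mulr1 => H.
  transitivity (u1 * (v1 * (u1 * v1))); last by ring.
  rewrite -H.
    by congr E; apply/funext => w; rewrite !big_cons big_nil /g /= mulr1; ring.
  by rewrite /key /= !inE !xpair_eqE !eqxx (negPf ts) (negPf ij) eq_sym (negPf ij).
under eq_fun do rewrite expr2 mulr_suml; rewrite mean_sum => [|t]; last first.
  by apply: bmfM; [apply: bmfM|apply: bmf_sum => s; apply: bmfM].
apply: (@le_trans _ _ (\sum_(t < n) (u2 * v2 + n%:R * (u1 ^+ 2 * v1 ^+ 2)))).
  apply: ler_sum => t _; under eq_fun do rewrite mulr_sumr.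
  rewrite mean_sum => [|s]; last by do !apply: bmfM.
  under eq_bigr do rewrite Ets.
  rewrite (bigD1 t)//= eqxx lerD2l.
  rewrite (eq_bigr (fun=> u1 ^+ 2 * v1 ^+ 2)); last by move=> s /negPf; rewrite eq_sym => ->.
  rewrite sumr_const -[leLHS]mulr_natl; apply: ler_wpM2r.
    by rewrite mulr_ge0 ?sqr_ge0.
  rewrite ler_nat.
  by apply: leq_trans (max_card _) _; rewrite card_ord.
by rewrite sumr_const card_ord -[leLHS]mulr_natl mulrDr [n%:R * (n%:R * _)]mulrA -expr2.
Qed.

Lemma mean_sq_offdiag (u v : R -> R) : bounded_mfun u -> bounded_mfun v ->
  E (fun w => \sum_i \sum_(j | i != j) (\sum_t u (X i t w) * v (X j t w)) ^+ 2) <=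
  m%:R ^+ 2 * (n%:R * (E (fun w => u (Z0 w) ^+ 2) * E (fun w => v (Z0 w) ^+ 2)) +
  n%:R ^+ 2 * (E (fun w => u (Z0 w)) ^+ 2 * E (fun w => v (Z0 w)) ^+ 2)).
Proof.
move=> bu bv; set B := (_ + _).
have B0 : 0 <= B.
  have E2 (h : R -> R) : 0 <= E (fun w => h (Z0 w) ^+ 2).
    by apply: mean_ge0 => w; exact: sqr_ge0.
  by apply: addr_ge0; apply: mulr_ge0 => //; try apply: mulr_ge0 => //; exact: sqr_ge0.
have bS i j : bounded_mfun (fun w => (\sum_t u (X i t w) * v (X j t w)) ^+ 2).
  by apply: bmfX; apply: bmf_sum => t; apply: bmfM; exact: bmf_comp.
rewrite mean_sum => [|i]; last exact: bmf_sum.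
apply: (@le_trans _ _ (\sum_(i < m) \sum_(j < m) B)).
  apply: ler_sum => i _; rewrite mean_sum//.
  rewrite [leRHS](bigID (fun j => i != j))/= ler_wpDr ?sumr_ge0//.
  by apply: ler_sum => j ij; exact: mean_sq_offdiag_entry.
by rewrite !sumr_const card_ord -mulrnA -[leLHS]mulr_natl natrM -expr2.
Qed.

End Moments.
End Array.

(** * Walks alternating between rows and columns *)

Section Walks.
Context {m n : nat}.
Implicit Types (i j : 'I_m) (t : 'I_n) (s : seq ('I_n * 'I_m)).

(** A walk from the row i is the list s of its steps: the step (t, j) goes through the
    column t to the row j, and so uses the entries at (i, t) and at (j, t). *)
Fixpoint edges i s : seq ('I_m * 'I_n) :=
  if s is (t, j) :: s' then (i, t) :: (j, t) :: edges j s' else [::].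

(** The absence of immediate returns encodes the removal of the diagonal. *)
Fixpoint proper_walk i s : bool :=
  if s is (t, j) :: s' then (i != j) && proper_walk j s' else true.

Definition rows i s : {set 'I_m} := [set j in i :: map snd s].
Definition cols s : {set 'I_n} := [set t in map fst s].
Definition edge_set i s : {set 'I_m * 'I_n} := [set e in edges i s].

Fixpoint walks k : seq (seq ('I_n * 'I_m)) :=
  if k is k'.+1 then [seq x :: s | x <- enum {: 'I_n * 'I_m}, s <- walks k']
  else [:: [::]].

Lemma size_edges i s : size (edges i s) = (2 * size s)%N.
Proof. by elim: s i => //= -[t j] s IH i /=; rewrite IH; lia. Qed.

Lemma size_walks k s : s \in walks k -> size s = k.
Proof.
elim: k s => [|k IH] s /=; first by rewrite inE => /eqP ->.
by case/allpairsP => -[x s'] /= [_ /IH <- ->].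
Qed.

Lemma rows_cons i t j s : rows i ((t, j) :: s) = i |: rows j s.
Proof. by apply/setP => x; rewrite !inE. Qed.

Lemma cols_cons t j s : cols ((t, j) :: s) = t |: cols s.
Proof. by apply/setP => x; rewrite !inE. Qed.

Lemma edge_set_cons i t j s :
  edge_set i ((t, j) :: s) = (i, t) |: ((j, t) |: edge_set j s).
Proof. by apply/setP => x; rewrite !inE. Qed.

Lemma edge_set_ends i s e : e \in edge_set i s ->
  (e.1 \in rows i s) && (e.2 \in cols s).
Proof.
elim: s i => [|[t j] s IH] i; first by rewrite inE.
rewrite edge_set_cons rows_cons cols_cons !inE.
case/or3P => [/eqP -> /=|/eqP -> /=|H]; rewrite ?eqxx ?orbT//.
by have := IH j; rewrite inE => /(_ H); rewrite !inE => /andP[-> ->]; rewrite !orbT.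
Qed.

(** Prepending a step adds at least one edge for each vertex that it adds: a new
    vertex cannot be the end of an old edge. *)
Lemma edge_set_grows i t j s :
  (#|edge_set i ((t, j) :: s)| >=
   #|edge_set j s| + (t \notin cols s) + (i \notin rows j s))%N.
Proof.
rewrite edge_set_cons !cardsU1 finset.in_setU1 xpair_eqE eqxx andbT.
have [iE|iE] := boolP ((i, t) \in edge_set j s).
  by have /andP[/= -> ->] := edge_set_ends iE; lia.
have [jE|jE] := boolP ((j, t) \in edge_set j s).
  have /andP[/= jr ->] := edge_set_ends jE.
  have [->|_] := eqVneq i j; first by rewrite jr; lia.
  by case: (_ \in _) => /=; lia.
have [ij|_] := eqVneq i j; last by case: (_ \in _); case: (_ \in _) => /=; lia.
have -> : i \in rows j s by rewrite ij !inE eqxx.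
by case: (_ \in _) => /=; lia.
Qed.

(** The graph of a walk is connected. *)
Lemma card_vertices_le i s : (#|rows i s| + #|cols s| <= #|edge_set i s| + 1)%N.
Proof.
elim: s i => [|[t j] s IH] i.
  rewrite (_ : rows i [::] = [set i]%SET) ?cards1; last by apply/setP => x; rewrite !inE.
  rewrite (_ : cols [::] = finset.set0) ?cards0; last by apply/setP => x; rewrite !inE.
  by lia.
have := edge_set_grows i t j s; have := IH j.
by rewrite rows_cons cols_cons !cardsU1; lia.
Qed.

(** A proper walk enters a column and leaves it through two different entries; edges at
    different columns are different. *)
Lemma card_cols_proper i s : proper_walk i s -> (2 * #|cols s| <= #|edge_set i s|)%N.
Proof.
elim: s i => [|[t j] s IH] i /=.
  by rewrite (_ : cols [::] = finset.set0) ?cards0; last by apply/setP => x; rewrite !inE.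
case/andP => ij /IH {}IH; rewrite cols_cons edge_set_cons !cardsU1.
have [tc|tc] := boolP (t \in cols s) => /=.
  by rewrite add0n (leq_trans IH)// addnA leq_addl.
have H x : (x, t) \in edge_set j s = false.
  by apply/negP => /edge_set_ends /andP[_ /=]; exact/negP.
by rewrite finset.in_setU1 !H xpair_eqE (negPf ij) /= mulnDr addnA leq_add2l.
Qed.

Section Weights.
Context {R : realType}.

(** A new element of the set has at most N values, which its weight 1/N compensates; an
    old one has #|A| values. *)
Lemma sum_weight_setU1 (N : nat) (A : {set 'I_N}) :
  \sum_(x < N) (N%:R ^- #|x |: A|%SET : R) <= #|A|.+1%:R * N%:R ^- #|A|.
Proof.
case: N A => [|N] A; first by rewrite big_ord0 mulr_ge0// invr_ge0 exprn_ge0.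
rewrite (bigID (mem A))/= -[X in X%:R * _]addn1 natrD mulrDl mul1r; apply: lerD.
  rewrite (eq_bigr (fun=> N.+1%:R ^- #|A|)) => [|x xA]; last first.
    by rewrite (finset.setUidPr _)// finset.sub1set.
  by rewrite sumr_const -[leLHS]mulr_natl.
rewrite (eq_bigr (fun=> N.+1%:R^-1 * N.+1%:R ^- #|A|)) => [|x xA]; last first.
  by rewrite cardsU1 xA exprS invfM.
rewrite sumr_const -[leLHS]mulr_natl mulrA ler_piMl ?invr_ge0 ?exprn_ge0//.
rewrite ler_pdivrMr ?ltr0Sn// mul1r ler_nat.
by apply: leq_trans (max_card _) _; rewrite card_ord.
Qed.

(** The number of walks with r rows and c columns is at most m^r n^c times a constant
    depending on the length only. Stating this as a weighted sum avoids classifying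
    walks by their shape: each step costs a factor [sum_weight_setU1] for its row and
    one for its column. *)
Lemma sum_walk_weight k :
  \sum_(i < m) \sum_(s <- walks k) (m%:R ^- #|rows i s| * n%:R ^- #|cols s| : R) <=
  (k.+1)`!%:R ^+ 2.
Proof.
elim: k => [|k IH].
  apply: (@le_trans _ _ (\sum_(i < m) m%:R^-1)).
    apply: ler_sum => i _; rewrite big_seq1.
    rewrite (_ : rows i [::] = [set i]%SET) ?cards1; last by apply/setP => x; rewrite !inE.
    rewrite (_ : cols [::] = finset.set0) ?cards0; last by apply/setP => x; rewrite !inE.
    by rewrite expr0 expr1 invr1 mulr1.
  rewrite sumr_const card_ord -[leLHS]mulr_natl (_ : 1`! = 1%N)// expr1n.
  by have [->|m0] := eqVneq m%:R (0 : R); rewrite ?mul0r ?ler01// divff.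
have w0 N a : 0 <= (N%:R ^- a : R) by rewrite invr_ge0 exprn_ge0.
rewrite factS natrM exprMn.
apply: le_trans (ler_wpM2l _ IH); last by rewrite exprn_ge0.
rewrite (eq_bigr (fun i => \sum_j \sum_(s <- walks k) \sum_t
    m%:R ^- #|i |: rows j s|%SET * n%:R ^- #|t |: cols s|%SET)); last first.
  move=> i _; rewrite /= big_allpairs_dep/= big_enum/=.
  rewrite [RHS](eq_bigr (fun j => \sum_t \sum_(s <- walks k)
    (m%:R ^- #|rows i ((t, j) :: s)| * n%:R ^- #|cols ((t, j) :: s)|))); last first.
    move=> j _; rewrite exchange_big/=; apply: eq_bigr => t _; apply: eq_bigr => s _.
    by rewrite rows_cons cols_cons.
  by rewrite [RHS]exchange_big/= [RHS]pair_big/=; apply: eq_bigr => -[t j] _.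
rewrite exchange_big/= mulr_sumr; apply: ler_sum => j _.
rewrite exchange_big/= mulr_sumr !big_seq; apply: ler_sum => s /size_walks sk.
have -> : \sum_(i < m) \sum_t (m%:R ^- #|i |: rows j s|%SET * n%:R ^- #|t |: cols s|%SET : R) =
   (\sum_(i < m) m%:R ^- #|i |: rows j s|%SET) * \sum_t n%:R ^- #|t |: cols s|%SET.
  by rewrite mulr_suml; apply: eq_bigr => i _; rewrite mulr_sumr.
have H (A : nat) (x : R) : (A <= k.+1)%N -> 0 <= x -> A.+1%:R * x <= k.+2%:R * x.
  by move=> Ak x0; rewrite ler_wpM2r// ler_nat.
have cr : (#|rows j s| <= k.+1)%N.
  by rewrite cardsE; apply: leq_trans (card_size _) _; rewrite /= size_map sk.
have cc : (#|cols s| <= k.+1)%N.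
  by rewrite cardsE; apply: leq_trans (card_size _) _; rewrite size_map sk.
rewrite expr2 mulrACA; apply: ler_pM.
- by apply: sumr_ge0.
- by apply: sumr_ge0.
- by apply: le_trans (sum_weight_setU1 _) _; exact: H.
- by apply: le_trans (sum_weight_setU1 _) _; exact: H.
Qed.
End Weights.
End Walks.

(** * Powers of the off-diagonal Gram matrix *)

Section OffGram.
Context {R : realType} {m n : nat}.
Implicit Types (y z : 'I_m -> 'I_n -> R).

(** The off-diagonal part of y z', for two arrays since splitting the entries of one
    array produces mixed terms. *)
Definition off_gram y z : 'M[R]_m :=
  \matrix_(i, j) if i == j then 0 else \sum_t y i t * z j t.

Definition frob2 (A : 'M[R]_m) : R := \sum_i \sum_j A i j ^+ 2.

Lemma off_gram_tr y z : (off_gram y z)^T = off_gram z y.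
Proof.
apply/matrixP => i j; rewrite !mxE eq_sym; case: eqP => // _.
by apply: eq_bigr => t _; rewrite mulrC.
Qed.

Lemma frob2_off_gram y z :
  frob2 (off_gram y z) = \sum_i \sum_(j | i != j) (\sum_t y i t * z j t) ^+ 2.
Proof.
apply: eq_bigr => i _; rewrite [RHS]big_mkcond/=; apply: eq_bigr => j _.
by rewrite mxE; case: eqP => //= _; rewrite expr0n.
Qed.

Lemma off_gramX_walks y k i j :
  (off_gram y y ^+ k) i j = \sum_(s <- walks k | proper_walk i s && (last i (map snd s) == j))
     \prod_(e <- edges i s) y e.1 e.2.
Proof.
elim: k i j => [|k IH] i j.
  by rewrite expr0 mxE big_mkcond big_seq1/= big_nil; case: eqP.
rewrite exprS mxE [RHS]big_mkcond/= [RHS]big_allpairs_dep/= big_enum/=.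
transitivity (\sum_(j' < m) \sum_t \sum_(s <- walks k)
   (if (i != j') && proper_walk j' s && (last j' (map snd s) == j)
    then \prod_(e <- (i, t) :: (j', t) :: edges j' s) y e.1 e.2 else 0)); last first.
  by rewrite exchange_big/= pair_big/=; apply: eq_bigr => -[t j'] _.
apply: eq_bigr => j' _; rewrite IH mxE.
have [ij|ij] := eqVneq i j'.
  by rewrite mul0r big1// => t _; rewrite big1.
rewrite mulr_suml; apply: eq_bigr => t _; rewrite mulr_sumr [LHS]big_mkcond.
apply: eq_bigr => s _ /=; case: ifP => // _.
by rewrite !big_cons /= mulrA.
Qed.

Lemma frob2_off_gramX y q : frob2 (off_gram y y ^+ q) =
  \sum_i \sum_(s <- walks (2 * q) | proper_walk i s && (last i (map snd s) == i))
     \prod_(e <- edges i s) y e.1 e.2.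
Proof.
apply: eq_bigr => i _; rewrite -off_gramX_walks mulnC exprM expr2 mxE.
apply: eq_bigr => j _; rewrite expr2; congr (_ * _).
have -> : (off_gram y y ^+ q) i j = ((off_gram y y ^+ q)^T) j i by rewrite mxE.
congr (fun_of_matrix _ j i); elim: q => [|q IH]; first by rewrite expr0 trmx1.
by rewrite [in LHS]exprSr trmx_mul IH off_gram_tr exprS.
Qed.

End OffGram.

(** * Trace moments of a centred bounded array *)

Section TraceMoment.
Context {d : measure_display} {T : measurableType d} {R : realType}.
Variable P : probability T R.
Variable Z0 : T -> R.
Local Notation E := (mean P).
Context {m n : nat} {X : 'I_m -> 'I_n -> T -> R}.
Hypothesis mZ : measurable_fun setT Z0.
Hypothesis iidX : iid_array P Z0 X.
Variables (g : R -> R) (K S : R).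
Hypothesis bg : bounded_mfun g.
Hypothesis gK : forall z, `|g z| <= K.
Hypothesis Eg0 : E (fun w => g (Z0 w)) = 0.
Hypothesis Eg2 : E (fun w => g (Z0 w) ^+ 2) <= S.

Let K0 : 0 <= K. Proof. exact: le_trans (normr_ge0 _) (gK 0). Qed.
Let S0 : 0 <= S.
Proof. by apply: le_trans Eg2; apply: mean_ge0 => w; exact: sqr_ge0. Qed.

Let bgX k : bounded_mfun (fun w => g (Z0 w) ^+ k).
Proof. by apply: bmfX; exact: bmf_comp. Qed.

Lemma mean_exp_le k : (2 <= k)%N -> `|E (fun w => g (Z0 w) ^+ k)| <= K ^+ (k - 2) * S.
Proof.
move=> k2; apply: le_trans (mean_norm _ _) _ => //.
apply: (@le_trans _ _ (E (fun w => K ^+ (k - 2) * g (Z0 w) ^+ 2))).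
  apply: mean_le => [||w]; [exact: bmf_norm|exact: bmfZ|].
  rewrite -{1}(subnK k2) exprD normrM [`|_ ^+ 2|]ger0_norm ?sqr_ge0//.
  rewrite ler_wpM2r ?sqr_ge0// normrX; apply: lerXn2r => //; rewrite nnegrE//.
by rewrite meanZ// ler_wpM2l// exprn_ge0.
Qed.

(** A nonzero mean forces each entry to be met at least twice, since an entry met once
    contributes the factor E g = 0. Two visits to each of the e distinct entries are
    paid with a variance, the remaining ones with the uniform bound. *)
Lemma mean_prod_edges (L : seq ('I_m * 'I_n)) :
  let e := #|[set x in L]| in
  E (fun w => \prod_(x <- L) g (X x.1 x.2 w)) != 0 ->
  (2 * e <= size L)%N /\
  `|E (fun w => \prod_(x <- L) g (X x.1 x.2 w))| <= S ^+ e * K ^+ (size L - 2 * e).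
Proof.
move=> e; rewrite (mean_prod_seq iidX L id (g := fun=> g))//=.
have cnt k : E (fun w => \prod_(a <- L | a == k) g (Z0 w)) =
    E (fun w => g (Z0 w) ^+ count_mem k L).
  by congr E; apply/funext => w; rewrite big_const_seq iter_mulr_1.
rewrite (eq_bigr _ (fun k _ => cnt k)) => H.
have c2 k : k \in [set x in L]%SET -> (2 <= count_mem k L)%N.
  rewrite inE -has_pred1 has_count => c0; case: leqP => // c1; exfalso.
  move/eqP: H; apply; rewrite (bigD1 k)//=.
  by rewrite (_ : count_mem k L = 1%N) ?Eg0 ?mul0r//; lia.
have c0 k : k \notin [set x in L]%SET -> count_mem k L = 0%N.
  by rewrite inE => /count_memPn.
have sL : (\sum_(k in [set x in L]%SET) count_mem k L = size L)%N.
  transitivity (\sum_k count_mem k L)%N.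
    by rewrite big_mkcond; apply: eq_bigr => k _; case: ifPn => // /c0.
  elim: (L) => [|x L' IH] /=; first by rewrite big1.
  by rewrite big_split/= IH (bigD1 x)//= eqxx big1 ?addn0 ?add1n// => k /negPf; rewrite eq_sym => ->.
have e2 : (2 * e <= size L)%N.
  by rewrite -sL mulnC -sum_nat_const; apply: leq_sum => k /c2.
split=> //; rewrite normr_prod (bigID (mem [set x in L]%SET))/= [X in _ * X]big1 ?mulr1; last first.
  by move=> k /c0 ->; under eq_fun do rewrite expr0; rewrite mean_cst normr1.
apply: (@le_trans _ _ (\prod_(k in [set x in L]%SET) (K ^+ (count_mem k L - 2) * S))).
  by apply: ler_prod => k /c2 kL; rewrite normr_ge0 mean_exp_le.
rewrite big_split/= prodr_const mulrC -/e; apply: ler_wpM2l; first exact: exprn_ge0.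
rewrite prodrXr -sL mulnC -sum_nat_const sumnB//.
Qed.

(** Each of the k steps costs at most 4 Q D S. Pair each column with a row, at the price
    m n = Q^2 for two edges; the other edges bring at most one row each, at the price
    m <= Q D; and two visits in excess cost K^2 = 4 Q. All three prices amount to Q for two
    visits, and the one vertex in excess of the edges is a row, whence the factor m. *)
Lemma walk_weight_le (r c e k : nat) (Q D : R) :
  (0 < m)%N -> (r + c <= e + 1)%N -> (2 * c <= e)%N -> (2 * e <= 2 * k)%N ->
  0 <= Q -> 1 <= D -> 1 <= S -> m%:R * n%:R = Q ^+ 2 -> m%:R <= Q * D -> K ^+ 2 = 4 * Q ->
  m%:R ^+ r * n%:R ^+ c * (S ^+ e * K ^+ (2 * k - 2 * e)) <= m%:R * (4 * Q * D * S) ^+ k.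
Proof.
move=> m0 rc ce ek Q0 D1 S1 mnQ mQ KQ.
have m1 : 1 <= m%:R :> R by rewrite ler1n.
have D0 : 0 <= D by exact: le_trans D1.
rewrite -mulnBr exprM KQ.
apply: (@le_trans _ _ (m%:R * (Q * D) ^+ (e - 2 * c) * (Q ^+ 2) ^+ c *
    (S ^+ e * (4 * Q) ^+ (k - e)))).
  rewrite ler_wpM2r ?mulr_ge0 ?exprn_ge0 ?mulr_ge0//.
  rewrite -mnQ [(m%:R * n%:R) ^+ c]exprMn mulrA ler_wpM2r ?exprn_ge0//.
  apply: (@le_trans _ _ (m%:R ^+ (1 + (e - 2 * c) + c))).
    by apply: ler_weXn2l => //; lia.
  rewrite !exprD expr1 ler_wpM2r ?exprn_ge0// ler_wpM2l//.
  by apply: lerXn2r => //; rewrite nnegrE// mulr_ge0.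
rewrite -!mulrA ler_wpM2l//.
have -> : (4 * (Q * (D * S))) ^+ k = 4 ^+ k * (Q ^+ k * (D ^+ k * S ^+ k)).
  by rewrite !exprMn.
have -> : (Q * D) ^+ (e - 2 * c) * ((Q ^+ 2) ^+ c * (S ^+ e * (4 * Q) ^+ (k - e))) =
    4 ^+ (k - e) * (Q ^+ k * (D ^+ (e - 2 * c) * S ^+ e)).
  have -> : Q ^+ k = Q ^+ (e - 2 * c) * (Q ^+ 2) ^+ c * Q ^+ (k - e).
    by rewrite -exprM -!exprD; congr (_ ^+ _); lia.
  by rewrite !exprMn; ring.
apply: ler_pM; rewrite ?exprn_ge0 ?mulr_ge0 ?exprn_ge0//.
  by apply: ler_weXn2l; [lra|lia].
rewrite ler_wpM2l ?exprn_ge0//; apply: ler_pM; rewrite ?exprn_ge0//.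
  by apply: ler_weXn2l; [lra|lia].
by apply: ler_weXn2l; [lra|lia].
Qed.

(** [walk_weight_le] bounds the contribution of a single walk by its weight in
    [sum_walk_weight], up to a factor common to all walks. *)
Lemma mean_frob2_off_gramX (Q D : R) q :
  0 <= Q -> 1 <= D -> 1 <= S -> m%:R * n%:R = Q ^+ 2 -> m%:R <= Q * D -> K ^+ 2 = 4 * Q ->
  E (fun w => frob2 (off_gram (fun i t => g (X i t w)) (fun i t => g (X i t w)) ^+ q)) <=
  (2 * q).+1`!%:R ^+ 2 * (m%:R * (4 * Q * D * S) ^+ (2 * q)).
Proof.
move=> Q0 D1 S1 mnQ mQ KQ; set B := m%:R * _.
have D0 : 0 <= D by exact: le_trans D1.
have B0 : 0 <= B by rewrite mulr_ge0// exprn_ge0// !mulr_ge0.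
have mX i t : measurable_fun setT (X i t) by case: iidX.
have bL (L : seq ('I_m * 'I_n)) : bounded_mfun (fun w => \prod_(x <- L) g (X x.1 x.2 w)).
  by apply: bmf_prod => x; exact: bmf_comp.
under eq_fun do rewrite frob2_off_gramX.
rewrite mean_sum => [|i]; last exact: bmf_sum.
apply: (@le_trans _ _ (\sum_(i < m) \sum_(s <- walks (2 * q))
    m%:R ^- #|rows i s| * n%:R ^- #|cols s| * B)); last first.
  under eq_bigr do rewrite -mulr_suml; rewrite -mulr_suml ler_wpM2r//.
  exact: sum_walk_weight.
apply: ler_sum => i _; rewrite mean_sum// big_mkcond/= !big_seq; apply: ler_sum => s sk.
have W0 : 0 <= m%:R ^- #|rows i s| * n%:R ^- #|cols s| * B.
  by apply: mulr_ge0 => //; apply: mulr_ge0; rewrite invr_ge0 exprn_ge0.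
case: ifP => // /andP[ps _].
have [->//|nz] := eqVneq (E (fun w => \prod_(x <- edges i s) g (X x.1 x.2 w))) 0.
have [e2 Ele] := mean_prod_edges nz.
rewrite size_edges (size_walks sk) in e2 Ele.
have m0 : (0 < m)%N by exact: leq_ltn_trans (ltn_ord i).
have n0 : (0 < n)%N \/ #|cols s| = 0%N.
  case: (n) s {sk W0 ps nz e2 Ele} => [|n'] s; [right|by left].
  by apply/eqP; rewrite -leqn0; apply: leq_trans (max_card _) _; rewrite card_ord.
have nc : n%:R ^+ #|cols s| != 0 :> R.
  by case: n0 => [n0|->]; rewrite ?expr0 ?oner_eq0// expf_neq0// pnatr_eq0 -lt0n.
have mr : m%:R ^+ #|rows i s| != 0 :> R by rewrite expf_neq0// pnatr_eq0 -lt0n.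
have rc0 : 0 < m%:R ^+ #|rows i s| * n%:R ^+ #|cols s| :> R.
  by rewrite lt_def mulf_neq0// mulr_ge0 ?exprn_ge0.
apply: le_trans (ler_norm _) _; apply: le_trans Ele _.
rewrite -invfM [leRHS]mulrC ler_pdivlMr// [leLHS]mulrC.
apply: walk_weight_le => //; first exact: card_vertices_le.
exact: card_cols_proper.
Qed.

End TraceMoment.

(** * Operator norms *)

Section OperatorBound.
Context {R : realType}.

Definition sqn m (v : 'rV[R]_m) : R := \sum_i v 0 i ^+ 2.

Lemma sqn_ge0 m (v : 'rV[R]_m) : 0 <= sqn v.
Proof. by apply: sumr_ge0 => i _; exact: sqr_ge0. Qed.

Lemma sqnE m (v : 'rV[R]_m) : (v *m v^T) 0 0 = sqn v.
Proof. by rewrite mxE; apply: eq_bigr => i _; rewrite mxE expr2. Qed.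

Lemma sqn_gt0 m (v : 'rV[R]_m) : v != 0 -> 0 < sqn v.
Proof.
move=> v0; rewrite lt_def sqn_ge0 andbT; apply: contra v0 => /eqP/psumr_eq0P H.
apply/eqP/matrixP => i j; rewrite mxE ord1; apply/eqP; rewrite -sqrf_eq0.
by apply/eqP/H => // k _; exact: sqr_ge0.
Qed.

Lemma sqnZ m a (v : 'rV[R]_m) : sqn (a *: v) = a ^+ 2 * sqn v.
Proof. by rewrite mulr_sumr; apply: eq_bigr => i _; rewrite mxE exprMn. Qed.

Lemma sqnD_le m (u v : 'rV[R]_m) : sqn (u + v) <= 2 * (sqn u + sqn v).
Proof.
rewrite -big_split/= mulr_sumr; apply: ler_sum => i _; rewrite mxE.
by have := sqr_ge0 (u 0 i - v 0 i); nra.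
Qed.

Lemma cauchy_schwarz (I : finType) (a b : I -> R) :
  (\sum_i a i * b i) ^+ 2 <= (\sum_i a i ^+ 2) * (\sum_i b i ^+ 2).
Proof.
have : 0 <= \sum_i \sum_j (a i * b j - a j * b i) ^+ 2.
  by apply: sumr_ge0 => i _; apply: sumr_ge0 => j _; exact: sqr_ge0.
rewrite (_ : \sum_i _ = 2 * ((\sum_i a i ^+ 2) * (\sum_i b i ^+ 2)) -
   2 * (\sum_i a i * b i) ^+ 2); first by lra.
transitivity (\sum_i \sum_j (a i ^+ 2 * b j ^+ 2 + a j ^+ 2 * b i ^+ 2 -
   2 * ((a i * b i) * (a j * b j)))).
  by apply: eq_bigr => i _; apply: eq_bigr => j _; ring.
have -> : (\sum_i a i * b i) ^+ 2 = \sum_i \sum_j (a i * b i) * (a j * b j).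
  by rewrite expr2 mulr_suml; apply: eq_bigr => i _; rewrite mulr_sumr.
have -> : 2 * ((\sum_i a i ^+ 2) * \sum_i b i ^+ 2) =
   \sum_i \sum_j a i ^+ 2 * b j ^+ 2 + \sum_i \sum_j a j ^+ 2 * b i ^+ 2.
  rewrite [X in _ + X]exchange_big/= -mulr2n mulr_natl; congr (_ *+ 2).
  by rewrite mulr_suml; apply: eq_bigr => i _; rewrite mulr_sumr.
rewrite -big_split/= mulr_sumr -sumrB; apply: eq_bigr => i _.
by rewrite -big_split/= mulr_sumr -sumrB.
Qed.

(** The constant c plays the role of the square of the operator norm, which keeps square
    roots out of the bounds. *)
Definition opbound m n (A : 'M[R]_(m, n)) (c : R) := forall v, sqn (v *m A) <= c * sqn v.

Lemma opbound_frob2 m (A : 'M[R]_m) : opbound A (frob2 A).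
Proof.
move=> v; rewrite /frob2 exchange_big/= mulr_suml; apply: ler_sum => j _.
rewrite mxE mulrC; apply: le_trans (cauchy_schwarz _ _) _.
by rewrite ler_wpM2l// sqn_ge0.
Qed.

Lemma opbound_le m n (A : 'M[R]_(m, n)) c c' : c <= c' -> opbound A c -> opbound A c'.
Proof. by move=> cc H v; apply: le_trans (H v) _; rewrite ler_wpM2r ?sqn_ge0. Qed.

Lemma opboundD m n (A B : 'M[R]_(m, n)) a b :
  opbound A a -> opbound B b -> opbound (A + B) (2 * (a + b)).
Proof.
move=> HA HB v; rewrite mulmxDr; apply: le_trans (sqnD_le _ _) _.
by rewrite -[leRHS]mulrA; apply: ler_wpM2l => //; rewrite mulrDl lerD.
Qed.

(** For a symmetric matrix |v A|^2 = <v A^2, v> <= |v A^2| |v|; this replaces the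
    spectral theorem when passing from the powers of A to A. *)
Lemma opbound_sqrt m (A : 'M[R]_m) c : A^T = A -> 0 <= c ->
  opbound (A *m A) (c ^+ 2) -> opbound A c.
Proof.
move=> As c0 H v.
have E : sqn (v *m A) = \sum_i (v *m (A *m A)) 0 i * v 0 i.
  rewrite -sqnE trmx_mul As !mulmxA mxE.
  by apply: eq_bigr => i _; rewrite [v^T _ _]mxE.
rewrite -(@ler_pXn2r _ 2) ?nnegrE ?sqn_ge0// ?mulr_ge0 ?sqn_ge0//.
rewrite {1}E; apply: le_trans (cauchy_schwarz _ _) _.
rewrite exprMn [X in _ <= _ * X]expr2 mulrA ler_wpM2r ?sqn_ge0//.
exact: H.
Qed.

Lemma opbound_pow2 m (A : 'M[R]_m) c k : A^T = A -> 0 <= c ->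
  opbound (A ^+ (2 ^ k)) (c ^+ (2 ^ k)) -> opbound A c.
Proof.
elim: k A c => [|k IH] A c As c0; first by rewrite expn0 !expr1.
rewrite expnS !exprM => H; apply: opbound_sqrt => //.
apply: IH; last by rewrite [A ^+ 2]expr2 in H.
  by rewrite trmx_mul As.
exact: sqr_ge0.
Qed.

Lemma spectral_norm_le m n (A : 'M[R]_(m, n)) c : 0 <= c ->
  opbound A^T (c ^+ 2) -> 0 <= spectral_norm A <= c.
Proof.
move=> c0 H.
have ub s : singular_values A s -> s <= c.
  move=> [s0 /eigenvalueP[v vA v0]].
  rewrite -(@ler_pXn2r _ 2) ?nnegrE//.
  have := H v; rewrite -sqnE trmx_mul trmxK mulmxA -(mulmxA v) vA.
  by rewrite -scalemxAl mxE sqnE ler_pM2r// sqn_gt0.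
rewrite /spectral_norm; have [->|S0] := eqVneq (singular_values A) set0.
  by rewrite sup0 lexx c0.
have /set0P S0' := S0; have [s Ss] := S0'.
have hub : has_ubound (singular_values A) by exists c => x; exact: ub.
apply/andP; split; last by apply: ge_sup.
by apply: le_trans (ub_le_sup hub Ss); case: Ss.
Qed.

Lemma char_poly_horner n (A : 'M[R]_n) a : (char_poly A).[a] = \det (a%:M - A).
Proof.
rewrite -horner_evalE /char_poly -det_map_mx; congr (\det _).
by apply/matrixP => i j; rewrite !mxE /= /horner_eval hornerD hornerN hornerMn hornerX hornerC.
Qed.

(** Reduces the spectral norm to the zeros of one explicit function of s, continuous in s
    and polynomial in the entries of A. *)
Lemma spectral_norm_gtP m n (A : 'M[R]_(m, n)) c : 0 <= c ->
  c < spectral_norm A <-> exists2 s, c < s & \det ((s ^+ 2)%:M - A^T *m A) = 0.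
Proof.
move=> c0; have sE s : eigenvalue (A^T *m A) (s ^+ 2) <-> \det ((s ^+ 2)%:M - A^T *m A) = 0.
  by rewrite eigenvalue_root_char /root char_poly_horner; split => /eqP.
split=> [cs|[s cs /sE s2]].
  have [S0|/set0P S0] := eqVneq (singular_values A) set0.
    by move: cs; rewrite /spectral_norm S0 sup0 ltNge c0.
  by have [s [_ /sE s2] cs'] := sup_gt S0 cs; exists s.
have s0 : 0 <= s by exact: le_trans c0 (ltW cs).
apply: lt_le_trans cs _; apply: ub_le_sup; last by split.
exists (1 + frob2 (A^T *m A)) => x [x0 /eigenvalueP[v vA v0]].
have F0 : 0 <= frob2 (A^T *m A).
  by apply: sumr_ge0 => i _; apply: sumr_ge0 => j _; exact: sqr_ge0.
have := opbound_frob2 (A^T *m A) v.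
rewrite vA sqnZ ler_pM2r ?sqn_gt0// => H; rewrite leNgt; apply/negP => x1.
have x1' : 1 <= x by lra.
have x4 : x <= x ^+ (2 * 2) by apply: ler_eXnr.
by move: x4; rewrite exprM; lra.
Qed.

(** By compactness, a continuous function vanishes on a segment if and only if its
    infimum there is 0, and by density this infimum may be taken over rationals. The
    half-line s > c is the countable union of the segments [c + 1/(j+1), c + j + 1], so
    the event is obtained from measurable ones by countable operations. *)
Lemma measurable_spectral_norm_gt {d} {T : measurableType d} m n
    (A : T -> 'M[R]_(m, n)) c : 0 <= c ->
  (forall i j, measurable_fun setT (fun w => A w i j)) ->
  measurable [set w | c < spectral_norm (A w)].
Proof.
move=> c0 mA.
pose B w := (A w)^T *m A w.
pose f w s := \det ((s ^+ 2)%:M - B w).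
have mE s i j : measurable_fun setT (fun w => ((s ^+ 2)%:M - B w) i j).
  rewrite (_ : (fun w => _) =
      (fun w => s ^+ 2 *+ (i == j) - \sum_k A w k i * A w k j)).
    apply: measurable_funB; first exact: measurable_cst.
    by apply: measurable_sum => k; exact: measurable_funM.
  apply/funext => w; rewrite !mxE; congr (_ - _).
  by apply: eq_bigr => k _; rewrite mxE.
have mf s : measurable_fun setT (fun w => f w s).
  apply: measurable_sum => p; apply: measurable_funM; first exact: measurable_cst.
  by apply: measurable_prod => i _; exact: mE.
have cf w : continuous (f w).
  move=> x; rewrite (_ : f w = horner (char_poly (B w) \Po 'X^2)); first exact: continuous_horner.
  by apply/funext => s; rewrite horner_comp !hornerE char_poly_horner.
pose a (j : nat) := c + j.+1%:R^-1; pose b (j : nat) := c + j.+1%:R.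
rewrite (_ : [set w | _] = \bigcup_j \bigcap_k \bigcup_(q : rat)
    [set w | a j <= ratr q <= b j /\ `|f w (ratr q)| < k.+1%:R^-1]).
  apply: bigcupT_measurable => j; apply: bigcapT_measurable => k.
  apply: bigcupT_measurable_rat => q.
  have [qab|qab] := boolP (a j <= ratr q <= b j).
    rewrite (_ : [set w | _] = [set w | `|f w (ratr q)| < k.+1%:R^-1]).
      by apply: measurable_lt_set; [exact: measurableT_comp|exact: measurable_cst].
    by apply/seteqP; split => w /=; [case|].
  rewrite (_ : [set w | _] = set0)//; apply/seteqP; split => w //=.
  by case.
apply/seteqP; split => w /=.
  move=> /(spectral_norm_gtP _ c0)[s cs fs].
  have sc0 : 0 < s - c by rewrite subr_gt0.
  pose j := (Num.truncn ((s - c)^-1 + (s - c))).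
  have jP : (s - c)^-1 + (s - c) < j.+1%:R.
    by have /andP[] := truncn_itv (addr_ge0 (ltW (eqbRL (invr_gt0 _) sc0)) (ltW sc0)).
  have i0 : 0 < (s - c)^-1 by rewrite invr_gt0.
  have as_ : a j < s.
    rewrite /a -ltrBrDl invf_plt ?posrE//; lra.
  have sb : s < b j by rewrite /b; lra.
  exists j => // k _.
  have [r [[rab fr] [q _ qr]]] : ([set x | a j < x < b j /\ `|f w x| < k.+1%:R^-1]
      `&` range ratr) !=set0.
    apply: dense_rat; first by exists s; rewrite /= as_ sb /f fs normr0 invr_gt0 ltr0n.
    rewrite (_ : [set x | _] = `]a j, b j[ `&` ((fun x => `|f w x|) @^-1` [set x | x < k.+1%:R^-1])).
      apply: openI; first exact: interval_open.
      apply: open_comp; last exact: open_lt.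
      by move=> x _; apply: cvg_norm; exact: cf.
    by apply/seteqP; split => x /=; rewrite in_itv.
  exists q => //=; rewrite qr; split => //.
  by case/andP: rab => ? ?; rewrite !ltW.
move=> [j _ H]; apply/spectral_norm_gtP => //.
have abj : a j <= b j.
  by rewrite lerD2l (le_trans (_ : _ <= 1))// ?invf_le1 ?ler1n ?ltr0n.
have [|x xab xmin] := @EVT_min _ (fun x => `|f w x|) (a j) (b j) abj.
  apply: continuous_subspaceT => x; apply: cvg_norm; exact: cf.
exists x.
  move: xab; rewrite in_itv/= => /andP[ax _]; apply: lt_le_trans ax.
  by rewrite ltrDl invr_gt0 ltr0n.
apply/eqP; rewrite -normr_le0; apply/ler_addgt0Pl => e e0; rewrite addr0.
have [q _ [qab fq]] := H (Num.truncn e^-1) I.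
apply: le_trans (xmin (ratr q) _) _; first by rewrite in_itv.
apply/ltW/(lt_trans fq); rewrite invf_plt ?posrE//.
by have /andP[] := truncn_itv (ltW (eqbRL (invr_gt0 e) e0)).
Qed.

End OperatorBound.

(** * Growth rates along powers of two *)

Section Dyadic.
Context {R : realType}.

Lemma ltr_powR_exp (a x y : R) : 1 < a -> x < y -> a `^ x < a `^ y.
Proof.
move=> a1 xy; have a0 : 0 < a by exact: lt_trans a1.
by rewrite /powR gt_eqF// ltr_expR ltr_pM2r// ln_gt0.
Qed.

Lemma powR_large (C e : R) : 0 < e -> exists2 X0 : R, 1 <= X0 & forall x, X0 <= x -> C <= x `^ e.
Proof.
move=> e0; exists (Num.max 1 (`|C| `^ e^-1)); first by rewrite le_max lexx.
move=> x; rewrite ge_max => /andP[x1 xC].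
apply: le_trans (ler_norm _) _.
have -> : `|C| = (`|C| `^ e^-1) `^ e by rewrite -powRrM mulVf ?gt_eqF// powRr1.
by apply: ge0_ler_powR => //; rewrite ?nnegrE ?powR_ge0 ?ltW// (lt_le_trans _ x1).
Qed.

(** Reaches each y from the initial range by finitely many doublings. *)
Lemma dyadic_ind (Y : R) (Q : R -> Prop) : 0 < Y ->
  (forall y, y < 2 * Y -> Q y) ->
  (forall y, 2 * Y <= y -> Q (y / 2) -> Q y) -> forall y, Q y.
Proof.
move=> Y0 H0 HS y.
suff H k : forall y, y < 2 ^+ k.+1 * Y -> Q y.
  apply: (H (Num.truncn `|y / Y|)).
  rewrite -ltr_pdivrMr//; apply: le_lt_trans (ler_norm _) _.
  have /andP[_ h] := truncn_itv (normr_ge0 (y / Y)).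
  apply: lt_le_trans h _; rewrite -natrX ler_nat; exact/ltnW/ltn_expl.
elim: k => [|k IH] {}y; first by rewrite expr1; exact: H0.
move=> yk; have [|y2] := ltP y (2 * Y); first exact: H0.
apply: HS => //; apply: IH; rewrite ltr_pdivrMr// mulrAC.
by move: yk; rewrite exprSr.
Qed.

Lemma dyadic_upper (F : R -> R) (r : R) : 0 < r -> (forall y, F y <= 1) ->
  (exists Y, forall y, Y <= y -> F (2 * y) <= 2 `^ (- r) * F y) ->
  exists2 D : R, 0 < D & forall y, 1 <= y -> F y <= D * y `^ (- r).
Proof.
move=> r0 F1 [Y' HY']; pose Y := Num.max 1 Y'.
have Y1 : 1 <= Y by rewrite le_max lexx.
have Y0 : 0 < Y by exact: lt_le_trans Y1.
have HY y : Y <= y -> F (2 * y) <= 2 `^ (- r) * F y.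
  by rewrite ge_max => /andP[_]; exact: HY'.
exists ((2 * Y) `^ r); first by rewrite powR_gt0// mulr_gt0.
apply: (dyadic_ind Y0) => y.
  move=> yY y1; apply: le_trans (F1 _) _.
  have y0 : 0 < y by exact: lt_le_trans y1.
  rewrite powRN ler_pdivlMr ?powR_gt0// mul1r.
  by apply: ge0_ler_powR; rewrite ?nnegrE ?ltW// mulr_gt0.
move=> y2 IH y1; have yY : Y <= y / 2 by rewrite ler_pdivlMr// mulrC.
have {2}-> : y = 2 * (y / 2) by rewrite mulrC divfK.
have -> : F y = F (2 * (y / 2)) by congr F; rewrite mulrC divfK.
have y0 : 0 <= y / 2 by exact: le_trans (ltW Y0) yY.
apply: le_trans (HY _ yY) _; rewrite [(2 * (y / 2)) `^ _]powRM//.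
rewrite mulrCA ler_wpM2l ?powR_ge0//; apply: IH; exact: le_trans yY.
Qed.

Lemma dyadic_lower (F : R -> R) (s : R) : 0 < s ->
  (forall x y, x <= y -> F y <= F x) ->
  (exists Y, forall y, Y <= y -> 0 < F y) ->
  (exists Y, forall y, Y <= y -> 2 `^ (- s) * F y <= F (2 * y)) ->
  exists c Y : R, [/\ 0 < c, 1 <= Y & forall y, Y <= y -> c * y `^ (- s) <= F y].
Proof.
move=> s0 Fm [Y1 HY1] [Y2 HY2]; pose Y := Num.max 1 (Num.max Y1 Y2).
have Y1' : 1 <= Y by rewrite le_max lexx.
have Y0 : 0 < Y by exact: lt_le_trans Y1'.
have F0 y : Y <= y -> 0 < F y by rewrite !ge_max => /andP[_ /andP[h _]]; exact: HY1.
have HY y : Y <= y -> 2 `^ (- s) * F y <= F (2 * y).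
  by rewrite !ge_max => /andP[_ /andP[_ h]]; exact: HY2.
have F2 : 0 < F (2 * Y) by apply: F0; lra.
exists (F (2 * Y) * Y `^ s), Y; split => //; first by rewrite mulr_gt0 ?powR_gt0.
apply: (dyadic_ind Y0) => y.
  move=> y2 yY; have y0 : 0 < y by exact: lt_le_trans yY.
  apply: le_trans (_ : F (2 * Y) <= _); last by apply: Fm; exact: ltW.
  rewrite -mulrA ler_piMr ?(ltW F2)//.
  rewrite powRN ler_pdivrMr ?powR_gt0// mul1r.
  by apply: ge0_ler_powR; rewrite ?nnegrE//; exact: ltW.
move=> y2 IH yY; have yY' : Y <= y / 2 by rewrite ler_pdivlMr// mulrC.
have -> : F y = F (2 * (y / 2)) by congr F; rewrite mulrC divfK.
have {1}-> : y = 2 * (y / 2) by rewrite mulrC divfK.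
have y0 : 0 <= y / 2 by exact: le_trans (ltW Y0) yY'.
apply: le_trans (HY _ yY'); rewrite [(2 * (y / 2)) `^ _]powRM//.
by rewrite mulrCA ler_wpM2l ?powR_ge0//; exact: IH.
Qed.

End Dyadic.

(** * Tails and normalizing sequence *)

Section RegularVariation.
Context {d : measure_display} {T : measurableType d} {R : realType}.
Variable P : probability T R.
Variable Z0 : T -> R.
Hypothesis mZ : measurable_fun setT Z0.

Definition tail (y : R) : R := fine (P [set w | y < `|Z0 w|]).

Lemma measurable_tail_set y : measurable [set w | y < `|Z0 w|].
Proof. by apply: measurable_lt_set; [exact: measurable_cst|exact: measurableT_comp]. Qed.

Lemma tailE y : tail y = mean P (\1_[set w | y < `|Z0 w|]).
Proof. by rewrite mean_indic//; exact: measurable_tail_set. Qed.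

Lemma tail_nincr x y : x <= y -> tail y <= tail x.
Proof.
move=> xy; rewrite !tailE; apply: mean_le; try by apply: bmf_indic; exact: measurable_tail_set.
move=> w; rewrite !(indic_bool (fun w => _ < `|Z0 w|)) ler_nat.
by have [yz|] := boolP (y < _); rewrite ?(le_lt_trans xy yz).
Qed.

Lemma tail_le1 y : tail y <= 1.
Proof.
rewrite tailE -[leRHS](mean_cst P); apply: mean_le; last 2 first.
- exact: bmf_cst.
- by move=> w; rewrite (indic_bool (fun w => _ < `|Z0 w|)) lern1 leq_b1.
by apply: bmf_indic; exact: measurable_tail_set.
Qed.

Lemma tail_split y : 0 <= y ->
  tail y = fine (P [set w | y < Z0 w]) + fine (P [set w | Z0 w < - y]).
Proof.
move=> y0.
have m1 : measurable [set w | y < Z0 w] by apply: measurable_lt_set => //; exact: measurable_cst.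
have m2 : measurable [set w | Z0 w < - y] by apply: measurable_lt_set => //; exact: measurable_cst.
rewrite tailE -!mean_indic// -meanD; try exact: bmf_indic.
congr mean; apply/funext => w.
rewrite (indic_bool (fun w => _ < `|Z0 w|)) (indic_bool (fun w => y < Z0 w)) (indic_bool (fun w => Z0 w < _)).
rewrite real_ltr_normr ?num_real// -natrD; congr (_%:R).
rewrite ltrNr; case: (ltP y (Z0 w)) => // yz; case: (ltP (Z0 w) (- y)) => //=.
by move=> h; exfalso; lra.
Qed.

Variables (alpha pplus pminus : R) (L : R -> R).
Hypothesis alpha0 : 0 < alpha.
Hypothesis psum : pplus + pminus = 1.
Hypothesis hL : slowly_varying L.
Hypothesis htail : tail_balance P Z0 alpha pplus pminus L.

(** Adding the two one-sided tails, whose weights sum to 1, removes them. *)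
Lemma tail_equiv : tail x / (L x * x `^ (- alpha)) @[x --> +oo] --> (1 : R).
Proof.
have [h1 h2] := htail; rewrite -psum.
apply: cvg_trans (cvgD h1 h2); apply: near_eq_cvg; near=> x => /=.
rewrite tail_split ?mulrDl//; near: x; apply: nbhs_pinfty_ge; exact: num_real.
Unshelve. all: by end_near. Qed.

(** The tail is monotone, so its behaviour under the single scale 2 determines its order
    of magnitude up to arbitrarily small powers. *)
Lemma tail_doubling :
  (exists Y, forall y, Y <= y -> 0 < tail y) /\
  tail (2 * x) / tail x @[x --> +oo] --> 2 `^ (- alpha).
Proof.
have [[x0 [L0 _]] Lc] := hL.
have c2 : 2 * x @[x --> +oo] --> (+oo : set_system R).
  apply/cvgryPge => A; near=> x; have : A / 2 <= x by near: x; apply: nbhs_pinfty_ge; exact: num_real.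
  by rewrite ler_pdivrMr// mulrC.
have G1 := tail_equiv.
have G2 : tail (2 * x) / (L (2 * x) * (2 * x) `^ (- alpha)) @[x --> +oo] --> (1 : R).
  exact: (cvg_comp _ _ c2 G1).
have F0 : \forall x \near +oo, 0 < tail x.
  near=> x; have x1 : 0 < x by near: x; apply: nbhs_pinfty_gt; exact: num_real.
  have Lx : 0 < L x by apply: L0; near: x; apply: nbhs_pinfty_ge; exact: num_real.
  have : 0 < tail x / (L x * x `^ (- alpha)) by near: x; exact: cvgr_gt G1 _ ltr01.
  by rewrite pmulr_lgt0// invr_gt0 mulr_gt0// powR_gt0.
split.
  have [M [_ HM]] := F0; exists (M + 1) => y My; apply: HM.
  by apply: lt_le_trans My; rewrite ltrDl.
have H : tail (2 * x) / (L (2 * x) * (2 * x) `^ (- alpha)) *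
    (tail x / (L x * x `^ (- alpha)))^-1 * (L (2 * x) / L x) * 2 `^ (- alpha)
    @[x --> +oo] --> (1 * 1^-1 * 1 * 2 `^ (- alpha) : R).
  apply: cvgM; last exact: cvg_cst.
  apply: cvgM; last exact: Lc.
  by apply: cvgM => //; apply: cvgV => //; exact: oner_neq0.
rewrite invr1 !mul1r in H; apply: cvg_trans H; apply: near_eq_cvg; near=> x => /=.
have x1 : 0 < x by near: x; apply: nbhs_pinfty_gt; exact: num_real.
have Lx : 0 < L x by apply: L0; near: x; apply: nbhs_pinfty_ge; exact: num_real.
have L2x : 0 < L (2 * x).
  apply: L0; have : x0 / 2 <= x by near: x; apply: nbhs_pinfty_ge; exact: num_real.
  by rewrite ler_pdivrMr// mulrC.
have tx : 0 < tail x by near: x.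
rewrite powRM ?(ltW x1)//.
have p1 : 0 < x `^ (- alpha) by exact: powR_gt0.
have p2 : 0 < 2 `^ (- alpha) :> R by exact: powR_gt0.
by field; rewrite !gt_eqF.
Unshelve. all: by end_near. Qed.

Lemma tail_le (r : R) : 0 < r < alpha ->
  exists2 D : R, 0 < D & forall y, 1 <= y -> tail y <= D * y `^ (- r).
Proof.
move=> /andP[r0 ra]; have [[Y1 HY1] Hc] := tail_doubling.
apply: dyadic_upper => //; first exact: tail_le1.
have lt2 : 2 `^ (- alpha) < 2 `^ (- r) :> R.
  by rewrite ltr_powR_exp ?ltrN2 ?ltr1n.
have [M [_ HM]] := cvgr_lt _ Hc _ lt2.
exists (Num.max (M + 1) Y1) => y; rewrite ge_max => /andP[yM yY].
rewrite -ler_pdivrMr ?HY1//; apply/ltW/HM.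
by apply: lt_le_trans yM; rewrite ltrDl.
Qed.

Lemma tail_ge (s : R) : alpha < s ->
  exists c Y : R, [/\ 0 < c, 1 <= Y & forall y, Y <= y -> c * y `^ (- s) <= tail y].
Proof.
move=> as_; have [HY Hc] := tail_doubling.
apply: dyadic_lower => //; [exact: lt_trans as_|exact: tail_nincr|].
have lt2 : 2 `^ (- s) < 2 `^ (- alpha) :> R.
  by rewrite ltr_powR_exp ?ltrN2 ?ltr1n.
have [Y1 HY1] := HY.
have [M [_ HM]] := cvgr_gt _ Hc _ lt2.
exists (Num.max (M + 1) Y1) => y; rewrite ge_max => /andP[yM yY].
rewrite -ler_pdivlMr ?HY1//; apply/ltW/HM.
by apply: lt_le_trans yM; rewrite ltrDl.
Qed.

(** If a_k were less than k^(1/s), the tail at a_k would be at least of order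
    k^(- s'/s) for some s' < s, which is much larger than 1/k. *)
Lemma normalizing_ge (a : nat -> R) (s : R) : alpha < s -> normalizing_sequence P Z0 a ->
  \forall k \near \oo, k%:R `^ s^-1 <= a k.
Proof.
move=> as_ ha; have s0 : 0 < s by exact: lt_trans as_.
pose s' := (alpha + s) / 2.
have s's : s' < s by rewrite /s'; lra.
have as' : alpha < s' by rewrite /s'; lra.
have [c [Y [c0 Y1 cY]]] := tail_ge as'.
have e0 : 0 < 1 - s' / s by rewrite subr_gt0 ltr_pdivrMr// mul1r.
have [X1 X11 HX1] := powR_large (3 / c) e0.
have is0 : 0 < s^-1 by rewrite invr_gt0.
have [X2 X21 HX2] := powR_large Y is0.
near=> k; rewrite leNgt; apply/negP => ak.
have k0 : 0 < k%:R :> R by rewrite ltr0n; near: k; exact: nbhs_infty_gt.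
have t2 : tail (a k) < 2 / k%:R.
  rewrite ltr_pdivlMr// -[X in _ * X]invrK; near: k.
  by apply: (cvgr_lt _ ha); lra.
have kX1 : X1 <= k%:R by near: k; exact: nbhs_infty_ger.
have kX2 : X2 <= k%:R by near: k; exact: nbhs_infty_ger.
have := cY _ (HX2 _ kX2); rewrite -powRrM => h.
have := le_lt_trans (le_trans h (tail_nincr (ltW ak))) t2.
rewrite ltr_pdivlMr//; apply/negP; rewrite -leNgt.
have := HX1 _ kX1; rewrite powRD; last by rewrite (gt_eqF k0) implybT.
rewrite powRr1 ?ler0n// ler_pdivrMr//.
rewrite (_ : - (s' / s) = s^-1 * - s'); last by rewrite mulrN mulrC.
by lra.
Unshelve. all: by end_near. Qed.

End RegularVariation.

Lemma powRD_gt0 {R : realType} (x r s : R) : 0 < x -> x `^ (r + s) = x `^ r * x `^ s.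
Proof. by move=> x0; rewrite powRD// (gt_eqF x0) implybT. Qed.

(** * Truncated moments *)

Section TruncatedMoments.
Context {d : measure_display} {T : measurableType d} {R : realType}.
Variable P : probability T R.
Variable Z0 : T -> R.
Hypothesis mZ : measurable_fun setT Z0.
Local Notation E := (mean P).

Definition trunc (b z : R) : R := z * (`|z| <= b)%R%:R.

Lemma measurable_le_indic (b : R) : measurable_fun setT (fun z : R => (`|z| <= b)%R%:R : R).
Proof.
rewrite (_ : (fun z => _) = \1_[set z : R | `|z| <= b]).
  by apply/measurable_indicP; apply: measurable_le_set => //; exact: measurable_cst.
by apply/funext => z; rewrite (indic_bool (fun z => `|z| <= b)).
Qed.

Lemma trunc_le (b z : R) : 0 <= b -> `|trunc b z| <= b.
Proof.
by move=> b0; rewrite /trunc; case: (leP `|z| b); rewrite ?mulr1 ?mulr0 ?normr0.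
Qed.

Lemma trunc_norm_le (b z : R) : `|trunc b z| <= `|z|.
Proof. by rewrite /trunc; case: (leP `|z| b); rewrite ?mulr1 ?mulr0 ?normr0. Qed.

Lemma bmf_trunc (b : R) : 0 <= b -> bounded_mfun (trunc b : R -> R).
Proof.
move=> b0; split; last by exists b => z; exact: trunc_le.
by apply: measurable_funM => //; exact: measurable_le_indic.
Qed.

(** The truncated r-th absolute power: all moments of truncated variables are bounded
    through this one, at the price of a power of the truncation level. *)
Definition ptrunc (r b z : R) : R := `|z| `^ r * (`|z| <= b)%R%:R.

Lemma ptrunc_ge0 (r b z : R) : 0 <= ptrunc r b z.
Proof. by rewrite mulr_ge0 ?powR_ge0. Qed.

Lemma bmf_ptrunc (r b : R) : 0 <= r -> 0 <= b -> bounded_mfun (ptrunc r b : R -> R).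
Proof.
move=> r0 b0; split.
  apply: measurable_funM; last exact: measurable_le_indic.
  exact: (measurableT_comp (measurable_powR r) (@normr_measurable R setT)).
exists (b `^ r) => z; rewrite ger0_norm ?ptrunc_ge0// /ptrunc.
case: (leP `|z| b) => zb; rewrite ?mulr1 ?mulr0 ?powR_ge0//.
by apply: ge0_ler_powR.
Qed.

Variable alpha : R.
Hypothesis alpha0 : 0 < alpha.
Hypothesis tailP : forall r : R, 0 < r < alpha ->
  exists2 D : R, 0 < D & forall y, 1 <= y -> tail P Z0 y <= D * y `^ (- r).

(** On the layer 2^j < |z| <= 2^(j+1) the power is at most 2^((j+1) r), while the tail is
    of order 2^(-j r') with r < r' < alpha, so the layers form a geometric series. *)
Lemma truncated_moment (r : R) : 0 < r < alpha ->
  exists2 C : R, 1 <= C & forall b, 0 <= b -> E (fun w => ptrunc r b (Z0 w)) <= C.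
Proof.
move=> /andP[r0 ra]; pose r' := (r + alpha) / 2.
have rr' : r < r' by rewrite /r'; lra.
have [|D D0 HD] := tailP (_ : 0 < r' < alpha); first by apply/andP; split; rewrite /r'; lra.
pose q : R := 2 `^ (r - r').
have q0 : 0 < q by exact: powR_gt0.
have q1 : q < 1.
  by rewrite -[ltRHS](powRr0 2) ltr_powR_exp ?ltr1n// subr_lt0.
have q10 : 0 < 1 - q by rewrite subr_gt0.
exists (1 + D * 2 `^ r * (1 - q)^-1).
  by rewrite lerDl !mulr_ge0 ?powR_ge0 ?invr_ge0 ?ltW.
move=> b b0; pose J := Num.truncn b.
have bJ : b <= 2 ^+ J.
  have /andP[_ bJ] := truncn_itv b0.
  by apply: le_trans (ltW bJ) _; rewrite -natrX ler_nat; exact: ltn_expl.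
have bt j : bounded_mfun (fun w => \1_[set w | (2 ^+ j : R) < `|Z0 w|] w : R).
  by apply: bmf_indic; exact: measurable_tail_set.
apply: (@le_trans _ _ (E (fun w => 1 + \sum_(j < J) (2 ^+ j.+1) `^ r * \1_[set w | 2 ^+ j < `|Z0 w|] w))).
  apply: mean_le => [||w]; first by apply: bmf_comp => //; exact: bmf_ptrunc (ltW r0) b0.
    by apply: bmfD; [exact: bmf_cst|apply: bmf_sum => j; exact: bmfZ].
  under eq_bigr do rewrite (indic_bool (fun w => _ < `|Z0 w|)).
  have S0 : 0 <= \sum_(j < J) (2 ^+ j.+1) `^ r * (2 ^+ j < `|Z0 w|)%R%:R :> R.
    by apply: sumr_ge0 => j _; rewrite mulr_ge0 ?powR_ge0.
  rewrite /ptrunc; case: (leP `|Z0 w| b) => zb; last by rewrite mulr0 addr_ge0.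
  rewrite mulr1; have [z1|z1] := leP `|Z0 w| 1.
    apply: le_trans (_ : 1 <= _); last by rewrite lerDl.
    by rewrite -[leRHS]/((fun=> 1) r) -powR1; apply: ge0_ler_powR; rewrite ?nnegrE// ltW.
  have {zb} zJ := le_trans zb bJ.
  suff [j [jJ j1 j2]] : exists j, [/\ (j < J)%N, 2 ^+ j < `|Z0 w| & `|Z0 w| <= 2 ^+ j.+1].
    rewrite (bigD1 (Ordinal jJ))//= j1 mulr1 ler_wpDl// ler_wpDr//.
      by apply: sumr_ge0 => i _; rewrite mulr_ge0 ?powR_ge0.
    by apply: ge0_ler_powR; rewrite ?nnegrE ?exprn_ge0// ltW.
  elim: (J) zJ => [|k IH] zk; first by move: zk; rewrite expr0 leNgt z1.
  have [/IH[j [jk j1 j2]]|zk'] := leP `|Z0 w| (2 ^+ k); last by exists k.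
  by exists j; split => //; exact: ltnW.
rewrite meanD; [|exact: bmf_cst|by apply: bmf_sum => j; exact: bmfZ].
rewrite mean_cst lerD2l mean_sum => [|j]; last exact: bmfZ.
apply: (@le_trans _ _ (\sum_(j < J) D * 2 `^ r * q ^+ j)).
  apply: ler_sum => j _; rewrite meanZ// -tailE//.
  have jE (k : nat) (x : R) : (2 ^+ k) `^ x = (2 `^ x) ^+ k :> R.
    by rewrite -(@powR_mulrn _ 2 k)// -(powR_mulrn k (powR_ge0 2 x)) -!powRrM mulrC.
  apply: le_trans (ler_wpM2l (powR_ge0 _ _) (HD _ _)) _; first by rewrite exprn_ege1// ler1n.
  rewrite !jE /q powRD ?pnatr_eq0 ?implybT// exprMn exprS le_eqVlt; apply/orP; left; apply/eqP.
  by ring.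
rewrite -mulr_sumr ler_wpM2l ?mulr_ge0 ?powR_ge0 ?(ltW D0)//.
rewrite -[leRHS]mul1r ler_pdivlMr// mulrC -subr_ge0.
have -> : 1 - (1 - q) * \sum_(j < J) q ^+ j = q ^+ J.
  elim: (J) => [|k IH]; first by rewrite big_ord0 mulr0 subr0.
  by rewrite big_ord_recr/= mulrDr opprD addrA IH exprS; ring.
by rewrite exprn_ge0// ltW.
Qed.

Lemma trunc_sq_le (r b z : R) : r <= 2 -> 0 < b -> trunc b z ^+ 2 <= b `^ (2 - r) * ptrunc r b z.
Proof.
move=> r2 b0; rewrite /trunc /ptrunc; case: (leP `|z| b) => zb; last by rewrite !mulr0 expr0n.
rewrite !mulr1; have [->|z0] := eqVneq z 0.
  by rewrite expr0n mulr_ge0 ?powR_ge0.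
rewrite -real_normK ?num_real// -powR_mulrn// -[X in _ `^ X](subrK r).
rewrite powRD_gt0 ?normr_gt0// ler_wpM2r ?powR_ge0//.
by apply: ge0_ler_powR; rewrite ?nnegrE ?subr_ge0// ltW.
Qed.

Lemma band_sq_le (r K b z : R) : 2 <= r -> 0 < K -> K < `|z| ->
  trunc b z ^+ 2 <= K `^ (2 - r) * ptrunc r b z.
Proof.
move=> r2 K0 Kz; rewrite /trunc /ptrunc; case: (leP `|z| b) => zb; last by rewrite !mulr0 expr0n.
have z0 : 0 < `|z| by exact: lt_trans Kz.
rewrite !mulr1 -real_normK ?num_real// -powR_mulrn// -{1}[X in _ `^ X](subrK r).
rewrite powRD_gt0// ler_wpM2r ?powR_ge0//.
rewrite -opprB !powRN lef_pV2 ?posrE ?powR_gt0//.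
by apply: ge0_ler_powR; rewrite ?nnegrE ?subr_ge0// ltW.
Qed.

Lemma band_norm_le (r K b z : R) : 1 <= r -> 0 < K -> K < `|z| ->
  `|trunc b z| <= K `^ (1 - r) * ptrunc r b z.
Proof.
move=> r2 K0 Kz; rewrite /trunc /ptrunc; case: (leP `|z| b) => zb; last by rewrite !mulr0 normr0.
have z0 : 0 < `|z| by exact: lt_trans Kz.
rewrite !mulr1 -{1}[`|z|](powRr1 (ltW z0)) -{1}[1](subrK r).
rewrite powRD_gt0// ler_wpM2r ?powR_ge0//.
rewrite -opprB !powRN lef_pV2 ?posrE ?powR_gt0//.
by apply: ge0_ler_powR; rewrite ?nnegrE ?subr_ge0// ltW.
Qed.

Lemma trunc_norm_pow_le (r b z : R) : r <= 1 -> 0 < b ->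
  `|trunc b z| <= b `^ (1 - r) * ptrunc r b z.
Proof.
move=> r2 b0; rewrite /trunc /ptrunc; case: (leP `|z| b) => zb; last by rewrite !mulr0 normr0.
rewrite !mulr1; have [->|z0] := eqVneq z 0; first by rewrite normr0 mulr_ge0 ?powR_ge0.
rewrite -{1}[`|z|]powRr1// -{1}[1](subrK r).
rewrite powRD_gt0 ?normr_gt0// ler_wpM2r ?powR_ge0//.
by apply: ge0_ler_powR; rewrite ?nnegrE ?subr_ge0// ltW.
Qed.

Lemma trunc_norm_le1 (r b z : R) : 1 <= r -> `|trunc b z| <= 1 + ptrunc r b z.
Proof.
move=> r2; rewrite /trunc /ptrunc; case: (leP `|z| b) => zb; last by rewrite !mulr0 normr0 addr0.
rewrite !mulr1; have [z1|z1] := leP `|z| 1; first by rewrite ler_wpDr ?powR_ge0.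
apply: ler_wpDl => //; rewrite -[leLHS]powRr1//; exact: ler_powR (ltW z1) _ _ r2.
Qed.

Lemma trunc_sq_le1 (r b z : R) : 2 <= r -> trunc b z ^+ 2 <= 1 + ptrunc r b z.
Proof.
move=> r2; rewrite /trunc /ptrunc; case: (leP `|z| b) => zb; last first.
  by rewrite !mulr0 expr0n addr0.
rewrite !mulr1 -real_normK ?num_real//.
have [z1|z1] := leP `|z| 1; first by rewrite ler_wpDr ?powR_ge0// expr_le1.
apply: ler_wpDl => //; rewrite -powR_mulrn//; exact: ler_powR (ltW z1) _ _ r2.
Qed.

(** If both parts have an infinite integral, their difference oo - oo is -oo, and if only
    one of them does, the difference is infinite too; a zero mean excludes both. *)
Lemma integrable_of_mean0 : (\int[P]_w (Z0 w)%:E = 0)%E -> P.-integrable setT (EFin \o Z0).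
Proof.
move=> E0; have mE : measurable_fun setT (EFin \o Z0) by exact/measurable_EFinP.
apply/integrableP; split => //.
have := E0; rewrite integralE.
have -> : (\int[P]_w `|(EFin \o Z0) w| =
    \int[P]_w (EFin \o Z0)^\+ w + \int[P]_w (EFin \o Z0)^\- w)%E.
  rewrite -ge0_integralD//; last 2 first.
  - exact: measurable_funepos.
  - exact: measurable_funeneg.
  by apply: eq_integral => w _; rewrite -[LHS]/((abse \o (EFin \o Z0)) w) fune_abse.
have : (0 <= \int[P]_w (EFin \o Z0)^\+ w)%E by apply: integral_ge0.
have : (0 <= \int[P]_w (EFin \o Z0)^\- w)%E by apply: integral_ge0.
by case: (integral _ _ _) => [x| |]; case: (integral _ _ _) => [y| |]//= _ _ _; rewrite ltry.
Qed.

Lemma mean_trunc_cvg0 : (\int[P]_w (Z0 w)%:E = 0)%E ->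
  E (fun w => trunc n%:R (Z0 w)) @[n --> \oo] --> (0 : R).
Proof.
move=> E0; have iZ := integrable_of_mean0 E0.
have mtr n : measurable_fun setT (fun w => trunc n%:R (Z0 w)).
  by apply: (bmf_comp mZ _).1; exact: bmf_trunc.
have [|||||_ _ H] := @dominated_convergence _ T R P setT measurableT
  (fun n w => (trunc n%:R (Z0 w))%:E) (EFin \o Z0) (fun w => `|(Z0 w)%:E|%E).
- by move=> n; apply/measurable_EFinP.
- exact/measurable_EFinP.
- apply: aeW => w _; apply: cvg_near_cst; near=> n; rewrite /= /trunc.
  suff -> : `|Z0 w| <= n%:R by rewrite mulr1.
  by near: n; exact: nbhs_infty_ger.
- exact: integrable_abse.
- by apply: aeW => w n _ /=; rewrite lee_fin trunc_norm_le.
move: H; rewrite /= E0 => H.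
exact: (fine_cvg H).
Unshelve. all: by end_near. Qed.

Lemma trunc_outside (b z : R) : b < `|z| -> trunc b z = 0.
Proof. by move=> bz; rewrite /trunc leNgt bz mulr0. Qed.

Lemma trunc_inside (b z : R) : `|z| <= b -> trunc b z = z.
Proof. by move=> zb; rewrite /trunc zb mulr1. Qed.

(** The truncated means tend to E Z = 0, and the truncated means at b and at a larger
    level differ by the mean of Z on a band above b, where |z| <= b^(1-r) |z|^r. *)
Lemma mean_trunc_centered (r : R) : 1 <= r -> 0 < r < alpha ->
  (\int[P]_w (Z0 w)%:E = 0)%E ->
  exists2 C : R, 1 <= C & forall b, 1 <= b -> `|E (fun w => trunc b (Z0 w))| <= C * b `^ (1 - r).
Proof.
move=> r1 ra E0; have [C C1 HC] := truncated_moment ra; exists C => // b b1.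
have b0 : 0 < b by exact: lt_le_trans b1.
have r0 : 0 <= r by exact: le_trans r1.
have cvg0 := mean_trunc_cvg0 E0.
have bt (c : R) : 0 <= c -> bounded_mfun (fun w => trunc c (Z0 w)).
  by move=> c0; apply: bmf_comp => //; exact: bmf_trunc.
apply/ler_addgt0Pl => e e0.
have [n [nb ne]] : exists n : nat, b <= n%:R /\ `|E (fun w => trunc n%:R (Z0 w))| <= e.
  near \oo => n; exists n; split; first by near: n; exact: nbhs_infty_ger.
  by rewrite -[X in `|X|]subr0 distrC; near: n; exact: cvgr_dist_le.
have n0 : 0 <= n%:R :> R by [].
rewrite -[E _](subKr (E (fun w => trunc n%:R (Z0 w)))).
apply: le_trans (ler_normB _ _) _; apply: lerD => //.
rewrite -meanB; [|exact: bt|by apply: bt; exact: ltW].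
apply: le_trans (mean_norm _ _) _; first by apply: bmfB; [exact: bt|by apply: bt; exact: ltW].
apply: (@le_trans _ _ (E (fun w => b `^ (1 - r) * ptrunc r n%:R (Z0 w)))).
  apply: mean_le => [||w].
  - by apply: bmf_norm; apply: bmfB; [exact: bt|by apply: bt; exact: ltW].
  - by apply: bmfZ; apply: bmf_comp => //; exact: bmf_ptrunc.
  have [zb|bz] := leP `|Z0 w| b.
    by rewrite !trunc_inside ?(le_trans zb nb)// subrr normr0 mulr_ge0 ?powR_ge0 ?ptrunc_ge0.
  by rewrite (trunc_outside bz) subr0; exact: band_norm_le.
rewrite meanZ; last by apply: bmf_comp => //; exact: bmf_ptrunc.
by rewrite mulrC ler_wpM2r ?powR_ge0// HC.
Unshelve. all: by end_near. Qed.

End TruncatedMoments.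

(** * Splitting the off-diagonal Gram matrix *)

Section OffGramBounds.
Context {R : realType} {m n : nat}.
Implicit Types (y z : 'I_m -> 'I_n -> R).

Lemma off_gramD y1 y2 : off_gram (fun i t => y1 i t + y2 i t) (fun i t => y1 i t + y2 i t) =
  (off_gram y1 y1 + off_gram y1 y2) + (off_gram y2 y1 + off_gram y2 y2).
Proof.
apply/matrixP => i j; rewrite !mxE; case: eqP => _; first by rewrite !addr0.
by rewrite -!big_split/=; apply: eq_bigr => t _; ring.
Qed.

Lemma off_gram_sym_norm y (c : R) : 0 <= c -> opbound (off_gram y y) (c ^+ 2) ->
  spectral_norm (off_gram y y) <= c.
Proof.
by move=> c0 H; have /andP[] := @spectral_norm_le _ _ _ (off_gram y y) c c0 (ltac:(by rewrite off_gram_tr)).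
Qed.

Lemma spectral_norm_le_frob2 y (c : R) : 0 <= c -> frob2 (off_gram y y) <= c ^+ 2 ->
  spectral_norm (off_gram y y) <= c.
Proof.
by move=> c0 H; apply: off_gram_sym_norm => //; apply: opbound_le H _; exact: opbound_frob2.
Qed.

(** The constant 16 is the square of the number of pieces. One piece is bounded through
    a power, the others through their Frobenius norms. *)
Lemma spectral_norm_le_split y1 y2 (c : R) k : 0 <= c ->
  let s := c ^+ 2 / 16 in
  frob2 (off_gram y1 y1 ^+ (2 ^ k)) <= s ^+ (2 ^ k) ->
  frob2 (off_gram y1 y2) <= s -> frob2 (off_gram y2 y1) <= s -> frob2 (off_gram y2 y2) <= s ->
  spectral_norm (off_gram (fun i t => y1 i t + y2 i t) (fun i t => y1 i t + y2 i t)) <= c.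
Proof.
move=> c0 s H11 H12 H21 H22; apply: off_gram_sym_norm => //.
have s0 : 0 <= s by rewrite divr_ge0// sqr_ge0.
rewrite off_gramD (_ : c ^+ 2 = 2 * (2 * (s + s) + 2 * (s + s))); last by rewrite /s; field.
apply: opboundD; apply: opboundD.
- apply: (@opbound_pow2 _ _ _ _ k) => //; first exact: off_gram_tr.
  by apply: opbound_le H11 _; exact: opbound_frob2.
- by apply: opbound_le H12 _; exact: opbound_frob2.
- by apply: opbound_le H21 _; exact: opbound_frob2.
- by apply: opbound_le H22 _; exact: opbound_frob2.
Qed.

Lemma frob2_ge0 (A : 'M[R]_m) : 0 <= frob2 A.
Proof. by apply: sumr_ge0 => i _; apply: sumr_ge0 => j _; exact: sqr_ge0. Qed.

End OffGramBounds.

(** * Probability bounds by moments *)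

Section ProbabilityBounds.
Context {d : measure_display} {T : measurableType d} {R : realType}.
Variable P : probability T R.
Variable Z0 : T -> R.
Local Notation E := (mean P).
Context {m n : nat} {X : 'I_m -> 'I_n -> T -> R}.
Hypothesis mZ : measurable_fun setT Z0.
Hypothesis iidX : iid_array P Z0 X.

Let mX i t : measurable_fun setT (X i t).
Proof. by case: iidX. Qed.

Let Xw w i t := X i t w.

Lemma iid_array_mean g i t : bounded_mfun g -> E (fun w => g (X i t w)) = E (fun w => g (Z0 w)).
Proof.
move=> bg; have := mean_prod_uniq iidX (L := [:: (i, t)]) (key := id) (fun=> bg) isT.
by rewrite big_seq1 => <-; congr E; apply/funext => w; rewrite big_seq1.
Qed.

Lemma measurable_norm_off_gram (c : R) : 0 <= c ->
  measurable [set w | c < spectral_norm (off_gram (Xw w) (Xw w))].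
Proof.
move=> c0; apply: measurable_spectral_norm_gt => // i j.
have [->|ij] := eqVneq i j.
  rewrite (_ : (fun w => _) = fun=> 0); first exact: measurable_cst.
  by apply/funext => w; rewrite mxE eqxx.
rewrite (_ : (fun w => _) = fun w => \sum_t X i t w * X j t w).
  by apply: measurable_sum => t; exact: measurable_funM.
by apply/funext => w; rewrite mxE (negPf ij).
Qed.

Lemma mean_exceed (b : R) : E (fun w => \sum_i \sum_t (b < `|X i t w|)%R%:R) =
  m%:R * n%:R * tail P Z0 b.
Proof.
pose g (z : R) : R := (b < `|z|)%R%:R.
have bg : bounded_mfun g.
  rewrite (_ : g = \1_[set z : R | b < `|z|]); last first.
    by apply/funext => z; rewrite (indic_bool (fun z => b < `|z|)).
  by apply: bmf_indic; apply: measurable_lt_set; [exact: measurable_cst|exact: normr_measurable].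
have bgX i t : bounded_mfun (fun w => g (X i t w)) by exact: bmf_comp.
rewrite -[E _]/(E (fun w => \sum_i \sum_t g (X i t w))).
rewrite mean_sum => [|i]; last exact: bmf_sum.
rewrite (eq_bigr (fun=> n%:R * tail P Z0 b)) => [|i _].
  by rewrite sumr_const card_ord -[LHS]mulr_natl mulrA.
rewrite mean_sum// (eq_bigr (fun=> tail P Z0 b)) => [|t _].
  by rewrite sumr_const card_ord -[LHS]mulr_natl.
rewrite iid_array_mean// tailE//; congr E; apply/funext => w.
by rewrite (indic_bool (fun w => b < `|Z0 w|)).
Qed.

Lemma bmf_frob2 (g h : R -> R) : bounded_mfun g -> bounded_mfun h ->
  bounded_mfun (fun w => frob2 (off_gram (fun i t => g (X i t w)) (fun i t => h (X i t w)))).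
Proof.
move=> bg bh; under eq_fun do rewrite frob2_off_gram.
apply: bmf_sum => i; apply: bmf_sum => j; apply: bmfX; apply: bmf_sum => t.
by apply: bmfM; exact: bmf_comp.
Qed.

Lemma bmf_frob2X q (g : R -> R) : bounded_mfun g ->
  bounded_mfun (fun w => frob2 (off_gram (fun i t => g (X i t w)) (fun i t => g (X i t w)) ^+ q)).
Proof.
move=> bg; under eq_fun do rewrite frob2_off_gramX.
apply: bmf_sum => i; apply: bmf_sum => s; apply: bmf_prod => x.
exact: bmf_comp.
Qed.

Lemma mean_frob2 (g h : R -> R) : bounded_mfun g -> bounded_mfun h ->
  E (fun w => frob2 (off_gram (fun i t => g (X i t w)) (fun i t => h (X i t w)))) <=
  m%:R ^+ 2 * (n%:R * (E (fun w => g (Z0 w) ^+ 2) * E (fun w => h (Z0 w) ^+ 2)) +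
  n%:R ^+ 2 * (E (fun w => g (Z0 w)) ^+ 2 * E (fun w => h (Z0 w)) ^+ 2)).
Proof.
by move=> bg bh; under eq_fun do rewrite frob2_off_gram; exact: mean_sq_offdiag.
Qed.

(** The number of large entries serves as a bounded function whose mean dominates the
    probability that truncation at b changes the array. *)
Lemma exceed_cases (b : R) w : (1 <= \sum_i \sum_t (b < `|X i t w|)%R%:R :> R) \/
  (forall i t, `|X i t w| <= b).
Proof.
have [/forallP H|] := boolP [forall i, [forall t, `|X i t w| <= b]].
  by right => i t; have /forallP := H i.
rewrite negb_forall => /existsP[i]; rewrite negb_forall => /existsP[t].
rewrite -ltNge => bX; left; rewrite (bigD1 i)//= (bigD1 t)//= bX -addrA ler_wpDr//.
by rewrite addr_ge0//; repeat (apply: sumr_ge0 => ? _).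
Qed.

Lemma prob_le_mean (A : set T) (f : T -> R) : measurable A -> bounded_mfun f ->
  (forall w, 0 <= f w) -> (forall w, A w -> 1 <= f w) -> fine (P A) <= E f.
Proof.
move=> mA bf f0 f1; rewrite -mean_indic//; apply: mean_le => // [|w].
  exact: bmf_indic.
by rewrite indicE; have [wA|wA] := boolP (w \in A); [apply: f1; exact: set_mem|exact: f0].
Qed.

Lemma bmf_exceed (b : R) : bounded_mfun (fun w => \sum_i \sum_t (b < `|X i t w|)%R%:R : R).
Proof.
apply: bmf_sum => i; apply: bmf_sum => t.
rewrite (_ : (fun w => _) = \1_[set w | b < `|X i t w|]); last first.
  by apply/funext => w; rewrite (indic_bool (fun w => b < `|X i t w|)).
by apply: bmf_indic; apply: measurable_lt_set; [exact: measurable_cst|exact: measurableT_comp].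
Qed.

Let exceed_ge0 (b : R) w : 0 <= \sum_i \sum_t (b < `|X i t w|)%R%:R :> R.
Proof. by repeat (apply: sumr_ge0 => ? _). Qed.

(** If the norm exceeds c, either an entry exceeds b or the truncated array has a squared
    Frobenius norm above c^2; a single application of Markov's inequality to the sum of
    the two corresponding functions covers both cases. *)
Lemma prob_norm_trunc (b c : R) : 0 <= b -> 0 < c ->
  fine (P [set w | c < spectral_norm (off_gram (Xw w) (Xw w))]) <=
  m%:R * n%:R * tail P Z0 b + (c ^+ 2)^-1 * (m%:R ^+ 2 *
    (n%:R * E (fun w => trunc b (Z0 w) ^+ 2) ^+ 2 + n%:R ^+ 2 * E (fun w => trunc b (Z0 w)) ^+ 4)).
Proof.
move=> b0 c0; have bt := bmf_trunc b0.
have c2 : 0 < c ^+ 2 by rewrite exprn_gt0.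
pose F w := frob2 (off_gram (fun i t => trunc b (X i t w)) (fun i t => trunc b (X i t w))).
have bF : bounded_mfun F by exact: bmf_frob2.
apply: (@le_trans _ _ (E (fun w => \sum_i \sum_t (b < `|X i t w|)%R%:R + (c ^+ 2)^-1 * F w))).
  apply: prob_le_mean => [|||w /= cw].
  - exact: measurable_norm_off_gram (ltW c0).
  - by apply: bmfD; [exact: bmf_exceed|exact: bmfZ].
  - by move=> w; rewrite addr_ge0// mulr_ge0 ?invr_ge0 ?frob2_ge0 ?(ltW c2).
  have [H|H] := exceed_cases b w.
    by rewrite ler_wpDr// mulr_ge0 ?invr_ge0 ?frob2_ge0 ?(ltW c2).
  rewrite ler_wpDl// ler_pdivlMl// mulr1 leNgt; apply/negP => Fc.
  move: cw; apply/negP; rewrite -leNgt; apply: spectral_norm_le_frob2; first exact: ltW.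
  have -> : Xw w = fun i t => trunc b (X i t w); last exact: ltW.
  by apply/funext => i; apply/funext => t; rewrite trunc_inside.
rewrite meanD; [|exact: bmf_exceed|exact: bmfZ].
rewrite mean_exceed lerD2l meanZ// ler_wpM2l ?invr_ge0 ?(ltW c2)//.
apply: le_trans (mean_frob2 bt bt) _.
by rewrite -!expr2 -[(_ ^+ 2) ^+ 2 in leLHS]exprM.
Qed.

Definition cross_moment (f g : R -> R) : R :=
  E (fun w => frob2 (off_gram (fun i t => f (X i t w)) (fun i t => g (X i t w)))).

(** The same argument with one function for each way in which
    [spectral_norm_le_split] can fail. *)
Lemma prob_norm_split (f g : R -> R) (b c : R) k : 0 <= b -> 0 < c ->
  bounded_mfun f -> bounded_mfun g -> (forall z, `|z| <= b -> f z + g z = z) ->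
  fine (P [set w | c < spectral_norm (off_gram (Xw w) (Xw w))]) <=
  m%:R * n%:R * tail P Z0 b +
  (c ^+ 2 / 16)^-1 ^+ (2 ^ k) *
    E (fun w => frob2 (off_gram (fun i t => f (X i t w)) (fun i t => f (X i t w)) ^+ (2 ^ k))) +
  (c ^+ 2 / 16)^-1 * (cross_moment f g + cross_moment g f + cross_moment g g).
Proof.
move=> b0 c0 bf bg fg; set s := c ^+ 2 / 16.
have s0 : 0 < s by rewrite divr_gt0// exprn_gt0.
have is0 : 0 <= s^-1 by rewrite invr_ge0 ltW.
have isk : 0 <= s^-1 ^+ (2 ^ k) by rewrite exprn_ge0.
pose F w := frob2 (off_gram (fun i t => f (X i t w)) (fun i t => f (X i t w)) ^+ (2 ^ k)).
pose G (f g : R -> R) w : R := frob2 (off_gram (fun i t => f (X i t w)) (fun i t => g (X i t w))).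
have bF : bounded_mfun F by exact: bmf_frob2X.
have bG (f' g' : R -> R) : bounded_mfun f' -> bounded_mfun g' -> bounded_mfun (G f' g') by move=> *; exact: bmf_frob2.
have F0 w : 0 <= F w by exact: frob2_ge0.
have G0 f' g' w : 0 <= G f' g' w by exact: frob2_ge0.
pose H w := G f g w + G g f w + G g g w.
have bH : bounded_mfun H by apply: bmfD; [apply: bmfD|]; exact: bG.
have H0 w : 0 <= H w by rewrite !addr_ge0.
have EH : E H = cross_moment f g + cross_moment g f + cross_moment g g.
  rewrite /H meanD; [|by apply: bmfD; exact: bG|exact: bG].
  by rewrite meanD//; exact: bG.
rewrite -EH.
apply: (@le_trans _ _ (E (fun w => \sum_i \sum_t (b < `|X i t w|)%R%:R +
    s^-1 ^+ (2 ^ k) * F w + s^-1 * H w))).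
  apply: prob_le_mean => [|||w /= cw].
  - exact: measurable_norm_off_gram (ltW c0).
  - by apply: bmfD; [apply: bmfD; [exact: bmf_exceed|exact: bmfZ]|exact: bmfZ].
  - by move=> w; rewrite !addr_ge0// mulr_ge0.
  rewrite leNgt; apply/negP => lt1.
  have [e1|H1] := exceed_cases b w.
    have : 0 <= s^-1 ^+ (2 ^ k) * F w by rewrite mulr_ge0.
    have : 0 <= s^-1 * H w by rewrite mulr_ge0.
    by lra.
  have Fs : F w <= s ^+ (2 ^ k).
    rewrite leNgt; apply/negP => h.
    have : 1 < s^-1 ^+ (2 ^ k) * F w by rewrite exprVn ltr_pdivlMl ?exprn_gt0// mulr1.
    have : 0 <= s^-1 * H w by rewrite mulr_ge0.
    by have := exceed_ge0 b w; lra.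
  have Hs : H w <= s.
    rewrite leNgt; apply/negP => h.
    have : 1 < s^-1 * H w by rewrite ltr_pdivlMl// mulr1.
    have : 0 <= s^-1 ^+ (2 ^ k) * F w by rewrite mulr_ge0.
    by have := exceed_ge0 b w; lra.
  move: cw; apply/negP; rewrite -leNgt.
  have -> : Xw w = fun i t => f (X i t w) + g (X i t w).
    by apply/funext => i; apply/funext => t; rewrite fg.
  have g1 := G0 f g w; have g2 := G0 g f w; have g3 := G0 g g w.
  apply: (@spectral_norm_le_split _ _ _ _ _ _ k) => //; first exact: ltW.
  - by apply: le_trans Hs; rewrite -[leLHS]/(G f g w) /H; lra.
  - by apply: le_trans Hs; rewrite -[leLHS]/(G g f w) /H; lra.
  - by apply: le_trans Hs; rewrite -[leLHS]/(G g g w) /H; lra.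
rewrite meanD; [|by apply: bmfD; [exact: bmf_exceed|exact: bmfZ]|exact: bmfZ].
rewrite meanD; [|exact: bmf_exceed|exact: bmfZ].
by rewrite mean_exceed !meanZ.
Qed.

End ProbabilityBounds.

(** * Smallness of the norm for large arrays *)

Section PowerHelpers.
Context {R : realType}.

Lemma powR_small (C g eps : R) : 0 < g -> 0 < eps ->
  exists2 X0 : R, 1 <= X0 & forall x, X0 <= x -> C * x `^ (- g) <= eps.
Proof.
move=> g0 e0; have [X0 X1 HX] := powR_large (C / eps) g0; exists X0 => // x xX.
have x0 : 0 < x by apply: lt_le_trans xX; exact: lt_le_trans X1.
by rewrite powRN ler_pdivrMr ?powR_gt0// mulrC -ler_pdivrMr// HX.
Qed.

Lemma powR_exprn (x a : R) k : (x `^ a) ^+ k = x `^ (a * k%:R).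
Proof. by rewrite -powR_mulrn ?powR_ge0// -powRrM. Qed.

Lemma inv_sq_le (x e s c : R) : 0 < x -> 0 < e -> e * x `^ (2 / s) <= c ->
  (c ^+ 2)^-1 <= (e ^+ 2)^-1 * x `^ (- (4 / s)).
Proof.
move=> x0 e0 ec; have h : 0 < e * x `^ (2 / s) by rewrite mulr_gt0// powR_gt0.
have c0 : 0 < c by exact: lt_le_trans ec.
rewrite powRN -invfM lef_pV2 ?posrE ?mulr_gt0 ?exprn_gt0 ?powR_gt0//.
have -> : x `^ (4 / s) = (x `^ (2 / s)) ^+ 2 by rewrite powR_exprn mulrAC -natrM.
rewrite -exprMn; apply: lerXn2r => //; rewrite nnegrE ltW//.
Qed.

End PowerHelpers.

Section Core.
Context {d : measure_display} {T : measurableType d} {R : realType}.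
Variable P : probability T R.
Variable Z0 : T -> R.
Hypothesis mZ : measurable_fun setT Z0.
Local Notation E := (mean P).

(** What has to be shown about the law of the entries, with x = m n: the power
    x^(2/s) stands for the squared normalizing constant. The bound X0 is uniform over all
    arrays with at most x^(1/2 + delta) rows, so that the statement applies equally to Z
    and to its transpose. *)
Definition norm_small (delta s : R) := forall e eps : R, 0 < e -> 0 < eps ->
  exists X0 : R, forall (m n : nat) (X : 'I_m -> 'I_n -> T -> R) (c : R),
    iid_array P Z0 X -> X0 <= m%:R * n%:R ->
    m%:R <= (m%:R * n%:R) `^ (2^-1 + delta) ->
    e * (m%:R * n%:R) `^ (2 / s) <= c ->
    fine (P [set w | c < spectral_norm (off_gram (fun i t => X i t w) (fun i t => X i t w))]) <= eps.

(** Truncation at b = x^u. With m rows and n columns, the second moments contribute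
    m^2 n E^2 = m x E^2 to the squared Frobenius norm and the means contribute at most x^2
    times their fourth power; the two inequalities between exponents compare these
    with x^(4/s), the square of the threshold. *)
Lemma norm_small_frobenius (r theta u delta s D C : R) :
  0 < u -> 1 < u * r -> 3 / 2 + delta + 2 * u * (2 - r) < 4 / s ->
  2 + 4 * u * theta < 4 / s ->
  (forall y, 1 <= y -> tail P Z0 y <= D * y `^ (- r)) ->
  (forall b, 1 <= b -> E (fun w => trunc b (Z0 w) ^+ 2) <= C * b `^ (2 - r)) ->
  (forall b, 1 <= b -> `|E (fun w => trunc b (Z0 w))| <= C * b `^ theta) ->
  norm_small delta s.
Proof.
move=> u0 ur h2 h3 HD HC2 HC1 e eps e0 eps0.
have g1 : 0 < u * r - 1 by rewrite subr_gt0.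
have g2 : 0 < 4 / s - (3 / 2 + delta + 2 * u * (2 - r)) by rewrite subr_gt0.
have g3 : 0 < 4 / s - (2 + 4 * u * theta) by rewrite subr_gt0.
have eps3 : 0 < eps / 3 by rewrite divr_gt0.
have [X1 X11 H1] := powR_small D g1 eps3.
have [X2 X21 H2] := powR_small ((e ^+ 2)^-1 * C ^+ 2) g2 eps3.
have [X3 X31 H3] := powR_small ((e ^+ 2)^-1 * C ^+ 4) g3 eps3.
exists (Num.max X1 (Num.max X2 X3)) => m n X c iidX.
set x := m%:R * n%:R; rewrite !ge_max => /and3P[xX1 xX2 xX3] mx ec.
have x1 : 1 <= x by exact: le_trans xX1.
have x0 : 0 < x by exact: lt_le_trans x1.
have c0 : 0 < c by apply: lt_le_trans ec; rewrite mulr_gt0// powR_gt0.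
pose b := x `^ u.
have b1 : 1 <= b by rewrite -(powRr0 x); apply: ler_powR => //; exact: ltW.
have b0 : 0 <= b by exact: powR_ge0.
apply: le_trans (prob_norm_trunc mZ iidX b0 c0) _.
have T1 : x * tail P Z0 b <= D * x `^ (- (u * r - 1)).
  apply: le_trans (ler_wpM2l (ltW x0) (HD _ b1)) _.
  rewrite mulrCA -{1}[x](powRr1 (ltW x0)) -powRrM -powRD_gt0//.
  by rewrite (_ : 1 + u * - r = - (u * r - 1))//; ring.
have E20 : 0 <= E (fun w => trunc b (Z0 w) ^+ 2) by apply: mean_ge0 => w; exact: sqr_ge0.
have T2 : (c ^+ 2)^-1 * (m%:R ^+ 2 * (n%:R * E (fun w => trunc b (Z0 w) ^+ 2) ^+ 2)) <=
    (e ^+ 2)^-1 * C ^+ 2 * x `^ (- (4 / s - (3 / 2 + delta + 2 * u * (2 - r)))).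
  have -> : m%:R ^+ 2 * (n%:R * E (fun w => trunc b (Z0 w) ^+ 2) ^+ 2) =
      m%:R * x * E (fun w => trunc b (Z0 w) ^+ 2) ^+ 2 by rewrite /x; ring.
  apply: (@le_trans _ _ (((e ^+ 2)^-1 * x `^ (- (4 / s))) *
      (x `^ (2^-1 + delta) * x `^ 1 * (C * b `^ (2 - r)) ^+ 2))).
    apply: ler_pM; rewrite ?invr_ge0 ?exprn_ge0 ?(ltW c0)//.
    - by rewrite !mulr_ge0 ?exprn_ge0.
    - exact: inv_sq_le.
    apply: ler_pM; rewrite ?mulr_ge0 ?exprn_ge0//.
      by rewrite (powRr1 (ltW x0)); apply: ler_wpM2r => //; exact: ltW.
    by apply: lerXn2r; rewrite ?nnegrE ?HC2// (le_trans E20)// HC2.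
  rewrite exprMn powR_exprn -powRrM -powRD_gt0//.
  rewrite (_ : _ * _ = (e ^+ 2)^-1 * C ^+ 2 * (x `^ (- (4 / s)) *
     (x `^ (2^-1 + delta + 1) * x `^ (u * ((2 - r) * 2))))); last by ring.
  rewrite -!powRD_gt0// le_eqVlt; apply/orP; left; apply/eqP; congr (_ * _ `^ _).
  by lra.
have T3 : (c ^+ 2)^-1 * (m%:R ^+ 2 * (n%:R ^+ 2 * E (fun w => trunc b (Z0 w)) ^+ 4)) <=
    (e ^+ 2)^-1 * C ^+ 4 * x `^ (- (4 / s - (2 + 4 * u * theta))).
  have -> : m%:R ^+ 2 * (n%:R ^+ 2 * E (fun w => trunc b (Z0 w)) ^+ 4) =
      x ^+ 2 * `|E (fun w => trunc b (Z0 w))| ^+ 4.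
    rewrite -normrX [`|_ ^+ 4|]ger0_norm; last by rewrite (exprM _ 2 2) sqr_ge0.
    by rewrite /x; ring.
  apply: (@le_trans _ _ (((e ^+ 2)^-1 * x `^ (- (4 / s))) *
      (x `^ 2 * (C * b `^ theta) ^+ 4))).
    apply: ler_pM; rewrite ?invr_ge0 ?exprn_ge0 ?(ltW c0)//.
    - by rewrite mulr_ge0 ?exprn_ge0 ?(ltW x0).
    - exact: inv_sq_le.
    rewrite (powR_mulrn 2 (ltW x0)) ler_wpM2l ?exprn_ge0 ?(ltW x0)//.
    by apply: lerXn2r; rewrite ?nnegrE ?HC1// (le_trans _ (HC1 _ b1)).
  rewrite exprMn powR_exprn -powRrM.
  rewrite (_ : _ * _ = (e ^+ 2)^-1 * C ^+ 4 * (x `^ (- (4 / s)) *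
     (x `^ 2 * x `^ (u * (theta * 4))))); last by ring.
  rewrite -!powRD_gt0// le_eqVlt; apply/orP; left; apply/eqP; congr (_ * _ `^ _).
  by ring.
have {}T1 := le_trans T1 (H1 _ xX1).
have {}T2 := le_trans T2 (H2 _ xX2).
have {}T3 := le_trans T3 (H3 _ xX3).
by move: T1 T2 T3; rewrite /x !mulrDr; lra.
Qed.

Let bt (b : R) : 0 <= b -> bounded_mfun (fun w => trunc b (Z0 w)).
Proof. by move=> b0; apply: bmf_comp => //; exact: bmf_trunc. Qed.

(** Both parts are corrected by the same constant: the small one becomes centred, and the
    large one gets the mean of the entry truncated at b, which is tiny. *)
Definition small_part (K z : R) : R := trunc K z - E (fun w => trunc K (Z0 w)).
Definition large_part (K b z : R) : R :=
  trunc b z - trunc K z + E (fun w => trunc K (Z0 w)).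

Lemma bmf_small_part (K : R) : 0 <= K -> bounded_mfun (small_part K).
Proof. by move=> K0; apply: bmfB; [exact: bmf_trunc|exact: bmf_cst]. Qed.

Lemma bmf_large_part (K b : R) : 0 <= K -> 0 <= b -> bounded_mfun (large_part K b).
Proof.
by move=> K0 b0; apply: bmfD; [apply: bmfB; exact: bmf_trunc|exact: bmf_cst].
Qed.

Lemma mean_small_part (K : R) : 0 <= K -> E (fun w => small_part K (Z0 w)) = 0.
Proof. by move=> K0; rewrite meanB ?mean_cst ?subrr//; [exact: bt|exact: bmf_cst]. Qed.

Lemma mean_large_part (K b : R) : 0 <= K -> 0 <= b ->
  E (fun w => large_part K b (Z0 w)) = E (fun w => trunc b (Z0 w)).
Proof.
move=> K0 b0; rewrite meanD; [|by apply: bmfB; exact: bt|exact: bmf_cst].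
by rewrite meanB ?mean_cst ?subrK//; exact: bt.
Qed.

Lemma small_part_le (K z : R) : 0 <= K -> `|small_part K z| <= 2 * K.
Proof.
move=> K0; apply: le_trans (ler_normB _ _) _.
rewrite mulr_natl mulr2n lerD ?trunc_le//.
apply: le_trans (mean_norm P (bt K0)) _; rewrite -[leRHS](mean_cst P); apply: mean_le.
- by apply: bmf_norm; exact: bt.
- exact: bmf_cst.
- by move=> w; exact: trunc_le.
Qed.

Lemma mean_sq_small_part (K : R) : 0 <= K ->
  E (fun w => small_part K (Z0 w) ^+ 2) <= E (fun w => trunc K (Z0 w) ^+ 2).
Proof.
move=> K0; set mu := E (fun w => trunc K (Z0 w)).
have -> : (fun w => small_part K (Z0 w) ^+ 2) =
    (fun w => trunc K (Z0 w) ^+ 2 - (2 * mu * trunc K (Z0 w) - mu ^+ 2)).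
  by apply/funext => w; rewrite /small_part -/mu; ring.
rewrite meanB; [|by apply: bmfX; exact: bt|by apply: bmfB; [apply: bmfZ; exact: bt|exact: bmf_cst]].
rewrite meanB; [|by apply: bmfZ; exact: bt|exact: bmf_cst].
rewrite meanZ; last exact: bt.
by rewrite mean_cst -/mu; have := sqr_ge0 mu; lra.
Qed.

Lemma mean_sq_large_part (r C K b : R) : 2 <= r -> 1 <= C -> 1 <= K -> K <= b ->
  (forall b, 0 <= b -> E (fun w => ptrunc r b (Z0 w)) <= C) ->
  `|E (fun w => trunc K (Z0 w))| <= C * K `^ (1 - r) ->
  E (fun w => large_part K b (Z0 w) ^+ 2) <= (2 * C + 2 * C ^+ 2) * K `^ (2 - r).
Proof.
move=> r2 C1 K1 Kb HC; set mu := E _ => HK.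
have K0 : 0 < K by exact: lt_le_trans K1.
have b0 : 0 < b by exact: lt_le_trans Kb.
have r0 : 0 <= r by exact: le_trans r2.
have bp : bounded_mfun (fun w => ptrunc r b (Z0 w)).
  by apply: bmf_comp => //; apply: bmf_ptrunc => //; exact: ltW.
apply: (@le_trans _ _ (E (fun w => 2 * (K `^ (2 - r) * ptrunc r b (Z0 w)) + 2 * mu ^+ 2))).
  apply: mean_le => [||w].
  - by apply: bmfX; apply: bmf_comp => //; apply: bmf_large_part; exact: ltW.
  - by apply: bmfD; [do 2 apply: bmfZ|exact: bmf_cst].
  have H : (trunc b (Z0 w) - trunc K (Z0 w)) ^+ 2 <= K `^ (2 - r) * ptrunc r b (Z0 w).
    have [zK|Kz] := leP `|Z0 w| K.
      by rewrite !trunc_inside ?(le_trans zK Kb)// subrr expr0n mulr_ge0 ?powR_ge0 ?ptrunc_ge0.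
    by rewrite (trunc_outside Kz) subr0; exact: band_sq_le.
  rewrite /large_part -/mu.
  have := sqr_ge0 (trunc b (Z0 w) - trunc K (Z0 w) - mu).
  by move: H; rewrite !expr2; lra.
rewrite meanD; [|by do 2 apply: bmfZ|exact: bmf_cst].
rewrite mean_cst meanZ; last exact: bmfZ.
rewrite meanZ// [leRHS]mulrDl; apply: lerD.
  by rewrite -[leRHS]mulrA; apply: ler_wpM2l => //; rewrite mulrC ler_wpM2r ?powR_ge0// HC// ltW.
rewrite -[leRHS]mulrA; apply: ler_wpM2l => //.
apply: (@le_trans _ _ ((C * K `^ (1 - r)) ^+ 2)).
  by rewrite -real_normK ?num_real// lerXn2r// nnegrE// (le_trans _ HK).
rewrite exprMn powR_exprn ler_wpM2l ?sqr_ge0//; apply: ler_powR => //.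
by lra.
Qed.

(** The entries are cut at x^(1/4), the level at which two visits in excess cost as much
    in [walk_weight_le] as a new edge. The first exponent inequality says that
    x^(1/2 + delta), the norm of the small part, is below the threshold; the second one
    does the same for the Frobenius norms of the pieces containing the large part. *)
Lemma norm_small_split (r delta s D C : R) :
  2 < r -> 0 < delta -> 2^-1 + delta < 2 / s -> 2 + delta - r / 4 < 4 / s -> 1 <= C ->
  (forall y, 1 <= y -> tail P Z0 y <= D * y `^ (- r)) ->
  (forall b, 0 <= b -> E (fun w => ptrunc r b (Z0 w)) <= C) ->
  (forall b, 1 <= b -> `|E (fun w => trunc b (Z0 w))| <= C * b `^ (1 - r)) ->
  norm_small delta s.
Proof.
move=> r2 d0 h1 h2 C1 HD HC HC1 e eps e0 eps0.
pose h := 2 / s - (2^-1 + delta).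
have h0 : 0 < h by rewrite subr_gt0.
have s4 : 4 / s = 2 * (2 / s) by rewrite mulrA -natrM.
(* The gain is x^(-2 h q) against a loss of a factor m <= x, so q h >= 1 leaves
   x^-1. *)
have [k qh] : exists k, 1 <= (2 ^ k)%:R * h :> R.
  exists (Num.truncn h^-1); rewrite -ler_pdivrMr// mul1r.
  have /andP[_ hh] := truncn_itv (ltW (eqbRL (invr_gt0 h) h0)).
  by apply: le_trans (ltW hh) _; rewrite ler_nat; exact: ltn_expl.
set q := (2 ^ k)%N in qh.
pose S := 1 + C; pose G0 := 2 * C + 2 * C ^+ 2.
have S1 : 1 <= S by rewrite /S; lra.
have G00 : 0 <= G0 by rewrite /G0; have := sqr_ge0 C; lra.
(* One factor 16 comes from c^2 / 16, the other one is 4^2 from the price of a step. *)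
pose B1 := (2 * q).+1`!%:R ^+ 2 * (16 * 16 * S ^+ 2 * (e ^+ 2)^-1) ^+ q.
have S20 : 0 <= 16 * 16 * S ^+ 2 by apply: mulr_ge0; [rewrite mulr_ge0|exact: sqr_ge0].
have A0 : 0 <= 16 * 16 * S ^+ 2 * (e ^+ 2)^-1 by rewrite mulr_ge0// invr_ge0 sqr_ge0.
have g1 : 0 < r - 1 by lra.
have g3 : 0 < 4 / s - (2 + delta - r / 4) by rewrite subr_gt0.
have g4 : 0 < 4 / s + 4 * (r - 1) - 2 by lra.
have eps4 : 0 < eps / 4 by rewrite divr_gt0.
have [X1 X11 H1] := powR_small D g1 eps4.
have [X2 X21 H2] := powR_small B1 ltr01 eps4.
have [X3 X31 H3] := powR_small (16 * (e ^+ 2)^-1 * ((2 * S + G0) * G0)) g3 eps4.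
have [X4 X41 H4] := powR_small (16 * (e ^+ 2)^-1 * C ^+ 4) g4 eps4.
exists (Num.max X1 (Num.max X2 (Num.max X3 X4))) => m n X c iidX.
set x := m%:R * n%:R; rewrite !ge_max => /and4P[xX1 xX2 xX3 xX4] mx ec.
have x1 : 1 <= x by exact: le_trans xX1.
have x0 : 0 < x by exact: lt_le_trans x1.
have c0 : 0 < c by apply: lt_le_trans ec; rewrite mulr_gt0// powR_gt0.
have m1 : m%:R <= x.
  rewrite /x ler_peMr// ler1n lt0n; apply: contraTneq x0 => n0.
  by rewrite /x n0 mulr0 ltxx.
pose K := x `^ 4^-1.
have K1 : 1 <= K by rewrite -(powRr0 x); apply: ler_powR => //; clear -mZ bt; lra.
have K0 : 0 <= K by exact: powR_ge0.
have Kx : K <= x by rewrite -[leRHS](powRr1 (ltW x0)); apply: ler_powR => //; clear -mZ bt; lra.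
have xp := ltW x0.
pose f := small_part K; pose g := large_part K x.
have bf : bounded_mfun f by exact: bmf_small_part.
have bg : bounded_mfun g by exact: bmf_large_part.
have fg z : `|z| <= x -> f z + g z = z.
  by move=> zx; rewrite /f /g /small_part /large_part (trunc_inside zx); ring.
apply: le_trans (prob_norm_split mZ iidX k xp c0 bf bg fg) _.
have ie0 : 0 <= (e ^+ 2)^-1 by rewrite invr_ge0 sqr_ge0.
have ic0 : 0 <= (c ^+ 2)^-1 by rewrite invr_ge0 sqr_ge0.
have ic : (c ^+ 2 / 16)^-1 = 16 * (c ^+ 2)^-1 by rewrite invfM invrK mulrC.
have ice := inv_sq_le x0 e0 ec.
have T1 : x * tail P Z0 x <= D * x `^ (- (r - 1)).
  apply: le_trans (ler_wpM2l xp (HD _ x1)) _.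
  rewrite mulrCA -{1}[x](powRr1 xp) -powRD_gt0//.
  by rewrite (_ : 1 + - r = - (r - 1))//; ring.
have Ef2 : E (fun w => f (Z0 w) ^+ 2) <= S.
  apply: le_trans (mean_sq_small_part K0) _.
  apply: (@le_trans _ _ (E (fun w => 1 + ptrunc r K (Z0 w)))).
    have bp : bounded_mfun (fun w => ptrunc r K (Z0 w)).
      by apply: bmf_comp => //; apply: bmf_ptrunc => //; clear -mZ bt r2; lra.
    apply: mean_le => [||w]; [by apply: bmfX; exact: bt|by apply: bmfD => //; exact: bmf_cst|].
    by apply: trunc_sq_le1; exact: ltW.
  rewrite meanD ?mean_cst ?lerD2l ?HC//; first exact: bmf_cst.
  by apply: bmf_comp => //; apply: bmf_ptrunc => //; clear -mZ bt r2; lra.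
have Eg2 : E (fun w => g (Z0 w) ^+ 2) <= G0 * K `^ (2 - r).
  by apply: mean_sq_large_part => //; [exact: ltW|exact: HC1].
have Ef20 : 0 <= E (fun w => f (Z0 w) ^+ 2) by apply: mean_ge0 => w; exact: sqr_ge0.
have Eg20 : 0 <= E (fun w => g (Z0 w) ^+ 2) by apply: mean_ge0 => w; exact: sqr_ge0.
have Ef : E (fun w => f (Z0 w)) = 0 by exact: mean_small_part.
have Eg : E (fun w => g (Z0 w)) = E (fun w => trunc x (Z0 w)) by exact: mean_large_part.
pose W := m%:R * x * K `^ (2 - r).
have W0 : 0 <= W by rewrite !mulr_ge0 ?powR_ge0.
have mnx : m%:R ^+ 2 * n%:R = m%:R * x by rewrite /x; ring.
have Cfg : @cross_moment _ _ _ P _ _ X f g <= S * G0 * W.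
  apply: le_trans (mean_frob2 iidX bf bg) _.
  rewrite Ef expr0n mul0r mulr0 addr0 mulrA mnx.
  rewrite (_ : S * G0 * W = m%:R * x * (S * (G0 * K `^ (2 - r)))); last by rewrite /W; ring.
  by rewrite ler_wpM2l ?mulr_ge0// ler_pM.
have Cgf : @cross_moment _ _ _ P _ _ X g f <= S * G0 * W.
  apply: le_trans (mean_frob2 iidX bg bf) _.
  rewrite Ef [in 0 ^+ 2]expr0n mulr0 mulr0 addr0 mulrA mnx.
  rewrite (_ : S * G0 * W = m%:R * x * ((G0 * K `^ (2 - r)) * S)); last by rewrite /W; ring.
  by rewrite ler_wpM2l ?mulr_ge0// ler_pM.
have KG : K `^ (2 - r) <= 1.
  by rewrite -[leRHS](powRr0 K); apply: ler_powR => //; clear -mZ bt r2; lra.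
have Cgg : @cross_moment _ _ _ P _ _ X g g <= G0 ^+ 2 * W + x ^+ 2 * (C * x `^ (1 - r)) ^+ 4.
  apply: le_trans (mean_frob2 iidX bg bg) _.
  rewrite mulrDr; apply: lerD.
    rewrite mulrA mnx (_ : G0 ^+ 2 * W = m%:R * x * ((G0 * K `^ (2 - r)) * G0)); last by rewrite /W; ring.
    rewrite ler_wpM2l ?mulr_ge0// ler_pM//; apply: le_trans Eg2 _.
    by rewrite ler_piMr.
  rewrite mulrA -exprMn -/x ler_wpM2l ?sqr_ge0// Eg -exprD.
  rewrite -[leLHS]ger0_norm; last by rewrite (exprM _ 2 2) sqr_ge0.
  by rewrite normrX lerXn2r// ?nnegrE// ?HC1// (le_trans _ (HC1 _ x1)).
have SG0 : 0 <= (2 * S + G0) * G0 by rewrite mulr_ge0//; clear -mZ bt S1 G00; lra.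
have T3 : 16 * (c ^+ 2)^-1 * ((2 * S + G0) * G0 * W) <=
    16 * (e ^+ 2)^-1 * ((2 * S + G0) * G0) * x `^ (- (4 / s - (2 + delta - r / 4))).
  apply: (@le_trans _ _ (16 * ((e ^+ 2)^-1 * x `^ (- (4 / s))) *
     ((2 * S + G0) * G0 * (x `^ (2^-1 + delta) * x `^ 1 * x `^ (4^-1 * (2 - r)))))).
    apply: ler_pM; [by rewrite mulr_ge0|by rewrite mulr_ge0|by apply: ler_wpM2l|].
    apply: ler_wpM2l => //.
    by rewrite /W /K -powRrM (powRr1 xp) ler_wpM2r ?powR_ge0// ler_wpM2r.
  rewrite -!powRD_gt0//.
  rewrite (_ : _ * _ = 16 * (e ^+ 2)^-1 * ((2 * S + G0) * G0) * (x `^ (- (4 / s)) *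
     x `^ (2^-1 + delta + 1 + 4^-1 * (2 - r)))); last by ring.
  rewrite -!powRD_gt0// le_eqVlt; apply/orP; left; apply/eqP; congr (_ * _ `^ _).
  by clear -mZ bt; lra.
have T4 : 16 * (c ^+ 2)^-1 * (x ^+ 2 * (C * x `^ (1 - r)) ^+ 4) <=
    16 * (e ^+ 2)^-1 * C ^+ 4 * x `^ (- (4 / s + 4 * (r - 1) - 2)).
  apply: (@le_trans _ _ (16 * ((e ^+ 2)^-1 * x `^ (- (4 / s))) *
     (x `^ 2 * (C * x `^ (1 - r)) ^+ 4))).
    rewrite (powR_mulrn 2 xp) ler_wpM2r//; last by apply: ler_wpM2l.
    by rewrite mulr_ge0 ?exprn_ge0// mulr_ge0 ?powR_ge0//; clear -mZ bt C1; lra.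
  rewrite exprMn powR_exprn.
  rewrite (_ : _ * _ = 16 * (e ^+ 2)^-1 * C ^+ 4 * (x `^ (- (4 / s)) *
     (x `^ 2 * x `^ ((1 - r) * 4)))); last by ring.
  rewrite -!powRD_gt0// le_eqVlt; apply/orP; left; apply/eqP; congr (_ * _ `^ _).
  by ring.
have T2 : (c ^+ 2 / 16)^-1 ^+ q *
    E (fun w => frob2 (off_gram (fun i t => f (X i t w)) (fun i t => f (X i t w)) ^+ q)) <=
    B1 * x `^ (- 1).
  pose Q := x `^ 2^-1; pose Dd := x `^ delta.
  have Q0 : 0 <= Q by exact: powR_ge0.
  have Dd1 : 1 <= Dd by rewrite -(powRr0 x); apply: ler_powR => //; exact: ltW.
  have mnQ : m%:R * n%:R = Q ^+ 2 by rewrite powR_exprn mulVf// powRr1.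
  have mQ : m%:R <= Q * Dd by rewrite -powRD_gt0.
  have KQ : (2 * K) ^+ 2 = 4 * Q.
    rewrite exprMn powR_exprn -natrX; congr (_ * _ `^ _); clear -mZ bt; lra.
  have fK z : `|f z| <= 2 * K by exact: small_part_le.
  have H := mean_frob2_off_gramX (X := X) mZ iidX bf fK Ef Ef2 q Q0 Dd1 S1 mnQ mQ KQ.
  have isq : 0 <= (c ^+ 2 / 16)^-1 ^+ q by rewrite ic exprn_ge0// mulr_ge0.
  apply: le_trans (ler_wpM2l isq H) _.
  have Dd0 : 0 <= Dd by exact: powR_ge0.
  have -> : (c ^+ 2 / 16)^-1 ^+ q * ((2 * q).+1`!%:R ^+ 2 * (m%:R * (4 * Q * Dd * S) ^+ (2 * q))) =
     (2 * q).+1`!%:R ^+ 2 * (m%:R * (16 * 16 * S ^+ 2 * ((c ^+ 2)^-1 * (Q * Dd) ^+ 2)) ^+ q).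
    rewrite ic exprM (_ : 16 * 16 * S ^+ 2 * _ = 16 * (c ^+ 2)^-1 * (4 * Q * Dd * S) ^+ 2); last by ring.
    rewrite [in RHS]exprMn; move: (_ ^+ q) ((_ ^+ 2) ^+ q) (_`!%:R ^+ 2) => u v z.
    by ring.
  rewrite /B1 -[leRHS]mulrA; apply: ler_wpM2l; first by rewrite exprn_ge0.
  have QD : (Q * Dd) ^+ 2 = x `^ (1 + 2 * delta).
    by rewrite -powRD_gt0// powR_exprn; congr (_ `^ _); field.
  apply: (@le_trans _ _ (x * (16 * 16 * S ^+ 2 * (e ^+ 2)^-1 * x `^ (- (2 * h))) ^+ q)).
    apply: ler_pM => //.
      by apply: exprn_ge0; apply: mulr_ge0 => //; rewrite mulr_ge0 ?sqr_ge0.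
    apply: lerXn2r.
    - by rewrite nnegrE; apply: mulr_ge0 => //; rewrite mulr_ge0 ?sqr_ge0.
    - by rewrite nnegrE mulr_ge0 ?powR_ge0.
    rewrite -[leRHS]mulrA; apply: ler_wpM2l => //.
    rewrite QD; apply: le_trans (ler_wpM2r (powR_ge0 _ _) ice) _.
    rewrite -mulrA -powRD_gt0// le_eqVlt; apply/orP; left; apply/eqP; congr (_ * _ `^ _).
    by rewrite s4 /h; clear -mZ bt; lra.
  rewrite exprMn powR_exprn mulrCA; apply: ler_wpM2l.
    exact: exprn_ge0.
  rewrite -{1}[x](powRr1 xp) -powRD_gt0//; apply: ler_powR => //.
  by move: qh; rewrite mulrC; clear -mZ bt; lra.
have {}T1 := le_trans T1 (H1 _ xX1).
have {}T2 := le_trans T2 (H2 _ xX2).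
have {}T3 := le_trans T3 (H3 _ xX3).
have {}T4 := le_trans T4 (H4 _ xX4).
have T5 : (c ^+ 2 / 16)^-1 * (@cross_moment _ _ _ P _ _ X f g + @cross_moment _ _ _ P _ _ X g f +
    @cross_moment _ _ _ P _ _ X g g) <= eps / 4 + eps / 4.
  apply: le_trans (lerD T3 T4); rewrite ic -mulrDr ler_wpM2l ?mulr_ge0//.
  by move: Cfg Cgf Cgg; clear -mZ bt; lra.
by rewrite -/x; clear -mZ bt T1 T2 T5; lra.
Qed.

End Core.

(** * Slowly varying functions at the integers *)

Section SlowVariation.
Context {R : realType}.

Lemma lebesgue_measure_scale (rho : R) (A : set R) : 0 < rho -> measurable A ->
  lebesgue_measure ((fun x : R => rho^-1 * x) @^-1` A) = (rho%:E * lebesgue_measure A)%E.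
Proof.
move=> rho0 mA; have ir0 : 0 <= rho^-1 by rewrite invr_ge0 ltW.
pose f (x : measurableTypeR R) : measurableTypeR R := rho^-1 * x.
have mf : measurable_fun setT f by apply: measurable_funM.
have H : lebesgue_measure A = mscale (NngNum ir0) (pushforward lebesgue_measure f) A.
  move=> mf'; apply: lebesgue_measure_unique => //= _ [[a b]] _ <-.
  rewrite /mscale/= /pushforward.
  have -> : f @^-1` `]a, b] = `]rho * a, rho * b]%classic.
    apply/seteqP; split => x /=; rewrite /f !in_itv/= => /andP[h1 h2].
      by rewrite -ltr_pdivlMl// h1 -ler_pdivrMl// h2.
    by rewrite ltr_pdivlMl// h1 ler_pdivrMl// h2.
  rewrite !lebesgue_measure_itv/= !lte_fin ltr_pM2l//; case: ifP => _; last by rewrite mule0.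
  by rewrite -!EFinD -EFinM -mulrBr mulrA mulVf ?mul1r ?gt_eqF.
rewrite (H mf) /mscale/= muleA -EFinM mulfV ?gt_eqF// mul1e.
by [].
Qed.

(** Both A and rho A lie in [1, 5/2], which has measure 3/2, and each of them has measure
    more than 3/4. *)
Lemma scaled_sets_meet (A : set R) (rho : R) : measurable A -> A `<=` `[1, 2] ->
  1 <= rho <= 5 / 4 -> ((3 / 4)%:E < lebesgue_measure A)%E ->
  exists v w, [/\ A v, A w & v = rho * w].
Proof.
move=> mA A12 /andP[r1 r2] HA; apply: contrapT => H.
have rho0 : 0 < rho by exact: lt_le_trans r1.
pose B := (fun x : R => rho^-1 * x) @^-1` A.
have mB : measurable B.
  have mf : measurable_fun setT (fun x : R => rho^-1 * x) by apply: measurable_funM.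
  by rewrite /B -[X in measurable X]setTI; exact: mf.
have AB : A `&` B = set0.
  apply/seteqP; split => // v [Av Bv]; apply: H; exists v, (rho^-1 * v); split => //.
  by rewrite mulrA mulfV ?mul1r// gt_eqF.
have sub : A `|` B `<=` `[1, 5 / 2].
  move=> v [/A12|/A12] /=; rewrite !in_itv/= => /andP[h1 h2].
    by rewrite h1/=; lra.
  rewrite ler_pdivlMl// mulr1 in h1; rewrite ler_pdivrMl// in h2.
  by apply/andP; split; [lra|apply: le_trans h2 _; lra].
have : (lebesgue_measure (A `|` B) <= lebesgue_measure (`[1%R, (5 / 2)%R] : set R))%E.
  by apply: le_measure; rewrite ?inE//; exact: measurableU.
rewrite measureU// lebesgue_measure_itv/= lte_fin.
have -> : 1 < 5 / 2 :> R by lra.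
rewrite /B lebesgue_measure_scale// -EFinB.
have : ((3 / 4)%:E < rho%:E * lebesgue_measure A)%E.
  apply: lt_le_trans HA _; rewrite -[leLHS]mul1e; apply: lee_wpmul2r => //.
have := HA; case: (lebesgue_measure A) => [x| |]//.
- rewrite -EFinM -EFinD !lte_fin lee_fin; lra.
- by move=> _ _; rewrite gt0_muley ?lte_fin// addye// leye_eq.
Qed.

Variable ell : R -> R.
Hypothesis hell : slowly_varying ell.

(** A form of the uniform convergence theorem. By convergence at each v of [1, 2], the
    set of those v for which ell (v n) / ell n is close to 1 for all n >= N increases to
    [1, 2], so it has measure more than 3/4 for some N. For m <= n <= 5/4 m there are v
    and w in it with v = (n / m) w; then v m = w n, and ell m and ell n are both close
    to ell at this common point. *)
Lemma sv_uniform_integers (q : R) : 1 < q ->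
  exists N : nat, (forall n, (N <= n)%N -> 0 < ell n%:R) /\
  forall m n : nat, (N <= m)%N -> (m <= n)%N -> n%:R <= 5 / 4 * m%:R :> R ->
    ell n%:R <= q * ell m%:R /\ ell m%:R <= q * ell n%:R.
Proof.
move=> q1; have [[x0 [ell0 mell]] Hc] := hell.
pose eps := (q - 1) / (q + 1).
have eps0 : 0 < eps by rewrite divr_gt0//; lra.
have eps1 : eps < 1 by rewrite ltr_pdivrMr; lra.
have epsq : 1 + eps = q * (1 - eps) by rewrite /eps; field; lra.
(* Measurability of ell is known near infinity only, so ell is set to 0 below x0. *)
pose g : R -> R := ell \_ `[x0, +oo[%classic.
have mg : measurable_fun setT g.
  by apply/(measurable_restrictT ell (measurable_itv `[x0, +oo[)).
pose G (n : nat) : set R := [set v : R | `|g (v * n%:R) / ell n%:R - 1| <= eps].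
have mG n : measurable (G n).
  apply: measurable_le_set; last exact: measurable_cst.
  apply: measurableT_comp => //; apply: measurable_funB; last exact: measurable_cst.
  apply: measurable_funM; last exact: measurable_cst.
  apply: (measurableT_comp mg); exact: measurable_funM.
pose A (N : nat) : set R := `[1, 2]%classic `&` \bigcap_(n in [set n | (N <= n)%N]) G n.
have mA N : measurable (A N).
  by apply: measurableI => //; apply: bigcap_measurable => [|n _]; [by exists N => /=|exact: mG].
have ndA : nondecreasing_seq A.
  move=> N M NM; apply/subsetPset => v [v12 HG]; split => // n /= Mn; apply: HG => /=.
  exact: leq_trans Mn.
have UA : \bigcup_N A N = `[1, 2]%classic.
  apply/seteqP; split => [v [N _ []]//|v v12].
  have v0 : 0 < v by move: v12; rewrite /= in_itv/= => /andP[h _]; lra.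
  have := Hc v v0 => /cvgrPdist_le /(_ _ eps0) [M [_ HM]].
  pose N := (Num.truncn (Num.max `|M| `|x0|)).+1.
  have NP : Num.max `|M| `|x0| < N%:R.
    have h0 : 0 <= Num.max `|M| `|x0| by rewrite le_max normr_ge0.
    by have /andP[] := truncn_itv h0.
  exists N => //; split => // n /= Nn.
  have nN : Num.max `|M| `|x0| < n%:R by apply: lt_le_trans NP _; rewrite ler_nat.
  move: nN; rewrite gt_max => /andP[nM nx].
  have := HM n%:R (le_lt_trans (ler_norm _) nM); rewrite /G /= distrC /g patchE.
  rewrite mem_set//= in_itv/= andbT.
  apply: le_trans (ltW (le_lt_trans (ler_norm _) nx)) _.
  by rewrite ler_peMl//; move: v12; rewrite /= in_itv/= => /andP[].
have [N1 HN1] : exists N1, ((3 / 4)%:E < lebesgue_measure (A N1))%E.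
  have L12 : lebesgue_measure (\bigcup_N A N) = (2 - 1 : R)%:E.
    by rewrite UA lebesgue_measure_itv/= lte_fin ltr1n.
  have H : lebesgue_measure (A N) @[N --> \oo] --> (2 - 1 : R)%:E.
    rewrite -L12.
    exact: (nondecreasing_cvg_mu (mu := @lebesgue_measure R) mA (bigcupT_measurable A mA) ndA).
  have H' : fine (lebesgue_measure (A N)) @[N --> \oo] --> (2 - 1 : R) by exact: fine_cvg H.
  have lt34 : 3 / 4 < 2 - 1 :> R by lra.
  near \oo => N; exists N.
  have : 3 / 4 < fine (lebesgue_measure (A N)) by near: N; exact: cvgr_gt H' _ lt34.
  case: (lebesgue_measure (A N)) => [x| |] //= h; first by rewrite ltry.
  by move: h; rewrite ltNge divr_ge0.
pose N2 := (Num.truncn `|x0|).+1.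
have N2P n : (N2 <= n)%N -> x0 <= n%:R.
  move=> Nn; have /andP[_ h] := truncn_itv (normr_ge0 x0).
  apply: le_trans (ler_norm _) _; apply: le_trans (ltW h) _; by rewrite ler_nat.
exists (maxn N1 N2); split => [n|m n].
  by rewrite geq_max => /andP[_ /N2P]; exact: ell0.
rewrite geq_max => /andP[N1m N2m] mn nm.
have em : 0 < ell m%:R by apply: ell0; exact: N2P.
have en : 0 < ell n%:R by apply: ell0; apply: N2P; exact: leq_trans mn.
have m0 : 0 < m%:R :> R by rewrite ltr0n; exact: leq_trans N2m.
have n0 : 0 < n%:R :> R by rewrite ltr0n (leq_trans _ mn)// -(ltr0n R).
have mn' : m%:R <= n%:R :> R by rewrite ler_nat.
have [|v [w [[v12 Gv] [w12 Gw] vw]]] := @scaled_sets_meet (A N1) (n%:R / m%:R) (mA N1)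
  (@subIsetl _ _ _) _ HN1.
  by rewrite ler_pdivlMr// mul1r mn' ler_pdivrMr.
have vm : v * m%:R = w * n%:R by rewrite vw -mulrA mulrC; field; rewrite gt_eqF.
have := Gv m N1m; have := Gw n (leq_trans N1m mn); rewrite /G /= vm.
set z := g _ => /[!ler_norml] /andP[b1 b2] /andP[a1 a2].
have {}a1 : (1 - eps) * ell m%:R <= z.
  by rewrite -ler_pdivlMr//; lra.
have {}a2 : z <= (1 + eps) * ell m%:R by rewrite -ler_pdivrMr//; lra.
have {}b1 : (1 - eps) * ell n%:R <= z by rewrite -ler_pdivlMr//; lra.
have {}b2 : z <= (1 + eps) * ell n%:R by rewrite -ler_pdivrMr//; lra.
have e1 : 0 < 1 - eps by rewrite subr_gt0.
split; rewrite -(ler_pM2l e1) mulrCA mulrA -epsq.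
  exact: le_trans b1 a2.
exact: le_trans a1 b2.
Unshelve. all: by end_near. Qed.

End SlowVariation.

(** * Power bounds for slowly varying functions *)

Section SlowGrowth.
Context {R : realType}.

(** Going from n down to n - n / 10 costs a factor q, while n^delta decreases by at least
    the same factor, since the step reduces n to at most 19/20 n. *)
Lemma growth_of_ratio (phi : nat -> R) (N : nat) (q delta : R) :
  0 < delta -> 0 <= q -> q <= (20 / 19) `^ delta ->
  (forall m n : nat, (N <= m)%N -> (m <= n)%N -> n%:R <= 5 / 4 * m%:R :> R -> phi n <= q * phi m) ->
  exists2 C : R, 0 <= C & exists N1 : nat, forall n, (N1 <= n)%N -> phi n <= C * n%:R `^ delta.
Proof.
move=> d0 q0 qd H; pose N1 := maxn N 20.
pose C : R := \sum_(k < 2 * N1) `|phi k|.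
have C0 : 0 <= C by apply: sumr_ge0.
exists C => //; exists N1; elim/ltn_ind => n IH Nn.
have n0 : (20 <= n)%N by apply: leq_trans Nn; rewrite leq_maxr.
have n1 : 1 <= n%:R `^ delta.
  by rewrite -[leLHS](powRr0 (n%:R : R)); apply: ler_powR; [rewrite ler1n; lia|exact: ltW].
have [nN|nN] := ltnP n (2 * N1).
  apply: (@le_trans _ _ C); last by rewrite ler_peMr.
  rewrite /C (bigD1 (Ordinal nN))//= ler_wpDr//; first exact: sumr_ge0.
  exact: ler_norm.
(* For n >= 20 the rounding loses at most half of n / 10, whence the ratio 19/20; the
   inequality n <= 5/4 m is what the hypothesis on phi asks for. *)
pose m := (n - n %/ 10)%N.
have mn : (m < n)%N by rewrite /m; lia.
have Nm : (N1 <= m)%N by rewrite /m; lia.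
have nm : n%:R <= 5 / 4 * m%:R :> R.
  have : (4 * n <= 5 * m)%N by rewrite /m; lia.
  by rewrite -(ler_nat R) !natrM; lra.
have nm2 : m%:R <= 19 / 20 * n%:R :> R.
  have : (20 * m <= 19 * n)%N by rewrite /m; lia.
  by rewrite -(ler_nat R) !natrM; lra.
have NN : (N <= m)%N by apply: leq_trans Nm; rewrite leq_maxl.
apply: le_trans (H m n NN (ltnW mn) nm) _.
apply: le_trans (ler_wpM2l q0 (IH m mn Nm)) _.
rewrite mulrCA ler_wpM2l//.
apply: (@le_trans _ _ ((20 / 19) `^ delta * (19 / 20 * n%:R) `^ delta)).
  apply: ler_pM => //; rewrite ?powR_ge0//.
  by apply: ge0_ler_powR; rewrite ?nnegrE ?mulr_ge0// ?(ltW d0)// divr_ge0.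
rewrite -powRM ?mulr_ge0 ?divr_ge0// mulrA (_ : 20 / 19 * (19 / 20) = 1) ?mul1r//.
by field.
Qed.

Variable ell : R -> R.
Hypothesis hell : slowly_varying ell.

(** Apply [growth_of_ratio] to ell and to 1 / ell with delta / 2; the other half of delta
    absorbs the constants. *)
Lemma sv_power_bounds (delta : R) : 0 < delta ->
  \forall n \near \oo, n%:R `^ (- delta) <= ell n%:R <= n%:R `^ delta.
Proof.
move=> d0; pose d2 := delta / 2; have d20 : 0 < d2 by rewrite divr_gt0.
pose q : R := (20 / 19) `^ d2.
have q1 : 1 < q by rewrite /q -[ltLHS](powRr0 (20 / 19)) ltr_powR_exp//; lra.
have q0 : 0 <= q by exact: powR_ge0.
have [N [ell0 HN]] := sv_uniform_integers hell q1.
have [C1 C10 [N1 H1]] : exists2 C : R, 0 <= C & exists N1 : nat,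
    forall n, (N1 <= n)%N -> ell n%:R <= C * n%:R `^ d2.
  apply: (@growth_of_ratio (fun n => ell n%:R) N q) => // m n Nm mn nm.
  by have [] := HN m n Nm mn nm.
have [C2 C20 [N2 H2]] : exists2 C : R, 0 <= C & exists N1 : nat,
    forall n, (N1 <= n)%N -> (ell n%:R)^-1 <= C * n%:R `^ d2.
  apply: (@growth_of_ratio (fun n => (ell n%:R)^-1) N q) => // m n Nm mn nm.
  have [_ h] := HN m n Nm mn nm.
  have en := ell0 _ (leq_trans Nm mn); have em := ell0 _ Nm.
  by rewrite -[leLHS]mul1r ler_pdivrMr// -mulrA mulrCA ler_pdivlMl// mulr1.
have [X1 X11 HX1] := powR_large C1 d20.
have [X2 X21 HX2] := powR_large C2 d20.
near=> n.
have n0 : 0 < n%:R :> R by rewrite ltr0n; near: n; exact: nbhs_infty_gt.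
have en : 0 < ell n%:R by apply: ell0; near: n; exact: nbhs_infty_ge.
have dd : n%:R `^ delta = n%:R `^ d2 * n%:R `^ d2 by rewrite -powRD_gt0// /d2 -splitr.
apply/andP; split.
  rewrite powRN -[leRHS]invrK lef_pV2 ?posrE ?powR_gt0 ?invr_gt0//.
  apply: le_trans (H2 n _) _; first by near: n; exact: nbhs_infty_ge.
  rewrite dd ler_wpM2r ?powR_ge0// HX2//; near: n; exact: nbhs_infty_ger.
apply: le_trans (H1 n _) _; first by near: n; exact: nbhs_infty_ge.
rewrite dd ler_wpM2r ?powR_ge0// HX1//; near: n; exact: nbhs_infty_ger.
Unshelve. all: by end_near. Qed.

End SlowGrowth.

(** * Choice of exponents *)

Section Exponents.
Context {d : measure_display} {T : measurableType d} {R : realType}.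
Variable P : probability T R.
Variable Z0 : T -> R.
Hypothesis mZ : measurable_fun setT Z0.
Variable alpha : R.
Hypothesis alpha0 : 0 < alpha.
Hypothesis tailP : forall r : R, 0 < r < alpha ->
  exists2 D : R, 0 < D & forall y, 1 <= y -> tail P Z0 y <= D * y `^ (- r).
Local Notation E := (mean P).

Let bt (b : R) : 0 <= b -> bounded_mfun (fun w => trunc b (Z0 w)).
Proof. by move=> b0; apply: bmf_comp => //; exact: bmf_trunc. Qed.

Let bp (r b : R) : 0 <= r -> 0 <= b -> bounded_mfun (fun w => ptrunc r b (Z0 w)).
Proof. by move=> r0 b0; apply: bmf_comp => //; exact: bmf_ptrunc. Qed.

Lemma mean_trunc_sq (r C : R) : 0 <= r <= 2 ->
  (forall b, 0 <= b -> E (fun w => ptrunc r b (Z0 w)) <= C) ->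
  forall b, 1 <= b -> E (fun w => trunc b (Z0 w) ^+ 2) <= C * b `^ (2 - r).
Proof.
move=> /andP[r0 r2] HC b b1; have b0 : 0 < b by exact: lt_le_trans b1.
apply: (@le_trans _ _ (E (fun w => b `^ (2 - r) * ptrunc r b (Z0 w)))).
  apply: mean_le => [||w]; [by apply: bmfX; apply: bt; exact: ltW|by apply: bmfZ; apply: bp => //; exact: ltW|].
  exact: trunc_sq_le.
rewrite meanZ; last by apply: bp => //; exact: ltW.
by rewrite mulrC ler_wpM2r ?powR_ge0// HC// ltW.
Qed.

(** Without a centring hypothesis the truncated mean is bounded if r >= 1 and grows at
    most like b^(1-r) otherwise. *)
Lemma norm_mean_trunc (r C : R) : 0 < r -> 1 <= C ->
  (forall b, 0 <= b -> E (fun w => ptrunc r b (Z0 w)) <= C) ->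
  forall b, 1 <= b -> `|E (fun w => trunc b (Z0 w))| <= 2 * C * b `^ (Num.max 0 (1 - r)).
Proof.
move=> r0 C1 HC b b1; have b0 : 0 < b by exact: lt_le_trans b1.
have bpb : bounded_mfun (fun w => ptrunc r b (Z0 w)) by apply: bp; exact: ltW.
have btb : bounded_mfun (fun w => trunc b (Z0 w)) by apply: bt; exact: ltW.
apply: le_trans (mean_norm P btb) _.
have [r1|r1] := leP 1 r.
  have -> : Num.max 0 (1 - r) = 0 by apply/max_idPl; rewrite subr_le0.
  rewrite powRr0 mulr1.
  apply: (@le_trans _ _ (E (fun w => 1 + ptrunc r b (Z0 w)))).
    apply: mean_le => [||w]; [exact: bmf_norm|by apply: bmfD => //; exact: bmf_cst|].
    exact: trunc_norm_le1.
  rewrite meanD//; last exact: bmf_cst.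
  by rewrite mean_cst; have := HC b (ltW b0); lra.
have -> : Num.max 0 (1 - r) = 1 - r by apply/max_idPr; rewrite subr_ge0 ltW.
apply: (@le_trans _ _ (E (fun w => b `^ (1 - r) * ptrunc r b (Z0 w)))).
  apply: mean_le => [||w]; [exact: bmf_norm|exact: bmfZ|].
  by apply: trunc_norm_pow_le => //; exact: ltW.
rewrite meanZ// mulrC ler_wpM2r ?powR_ge0//; apply: le_trans (HC b (ltW b0)) _.
by lra.
Qed.

(** The squared threshold is x^(4 / alpha). A finite mean, even if it is not zero,
    contributes x^2 at most, and 2 < 4 / alpha. For alpha < 1 the mean truncated at
    x^(1 / alpha) is of order x^(1 / alpha - 1) and contributes x^(4 / alpha - 2). All exponents are perturbed by multiples of
    k = alpha (2 - alpha) / 100, where the factor 2 - alpha accounts for the margin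
    4 / alpha - 2 and the factor alpha keeps the perturbations of 1 / alpha bounded. *)
Lemma norm_small_lt2 : alpha < 2 -> exists delta s : R,
  [/\ 0 < delta < 2^-1, alpha < s & norm_small P Z0 delta s].
Proof.
move=> a2; have a0 := alpha0; pose v : R := alpha^-1.
have av : alpha * v = 1 by rewrite mulfV// gt_eqF.
have v0 : 0 < v by rewrite invr_gt0.
have v2 : 2^-1 < v by rewrite ltf_pV2 ?posrE.
pose w : R := (2 - alpha) / 100; pose k : R := alpha * w.
have w0 : 0 < w by rewrite divr_gt0//; lra.
have w2 : w < 2 / 100 by rewrite /w; lra.
have wa : 100 * w = 2 - alpha by rewrite /w; field.
have k0 : 0 < k by rewrite mulr_gt0.
have k1 : k <= 1 / 100.
  have : 100 * k = alpha * (2 - alpha) by rewrite /k -wa; ring.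
  have : alpha * (2 - alpha) = 1 - (1 - alpha) ^+ 2 by ring.
  have := sqr_ge0 (1 - alpha); lra.
have k2 : k ^+ 2 <= k / 100.
  rewrite expr2 ler_wpM2l ?(ltW k0)//; lra.
have kv : k * v = w by rewrite /k mulrAC av mul1r.
pose r : R := alpha * (1 - k); pose u : R := (1 + 2 * k) * v; pose s : R := ((1 - k) * v)^-1.
have r0 : 0 < r by rewrite mulr_gt0//; lra.
have ra : r < alpha by rewrite /r; nra.
have rr : 0 < r < alpha by rewrite r0 ra.
have s4 : 4 / s = 4 * v - 4 * w by rewrite /s invrK -kv; ring.
have ur : u * r = 1 + k - 2 * k ^+ 2.
  rewrite (_ : u * r = (alpha * v) * ((1 + 2 * k) * (1 - k))); last by rewrite /u /r; ring.
  by rewrite av; ring.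
have u0 : 0 < u by rewrite mulr_gt0//; lra.
have uE : u = v + 2 * w by rewrite /u -kv; ring.
have [C C1 HC] := truncated_moment mZ tailP rr.
have [D D0 HD] := tailP rr.
exists 10^-1, s; split.
- by apply/andP; split; lra.
- rewrite /s invfM /v invrK -subr_gt0 (_ : _ - _ = alpha * ((1 - k)^-1 - 1)); last by ring.
  by rewrite mulr_gt0// subr_gt0 invf_gt1; lra.
apply: (@norm_small_frobenius _ _ _ _ _ mZ r (Num.max 0 (1 - r)) u 10^-1 s D (2 * C)) => //.
- by rewrite ur; lra.
- rewrite s4 (_ : 2 * u * (2 - r) = 4 * u - 2 * (u * r)); last by ring.
  by rewrite ur uE; lra.
- rewrite s4; have [r1|r1] := leP 0 (1 - r).
    rewrite (_ : 4 * u * (1 - r) = 4 * u - 4 * (u * r)); last by ring.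
    by rewrite ur uE; lra.
  have : 4 * v - 2 = 200 * (w * v).
    rewrite (_ : 200 * (w * v) = 2 * v * (100 * w)); last by ring.
    by rewrite wa; lra.
  by nra.
- move=> b b1; apply: le_trans (mean_trunc_sq _ HC b1) _.
    by rewrite (ltW r0)/=; lra.
  by rewrite ler_wpM2r ?powR_ge0//; lra.
- exact: norm_mean_trunc.
Qed.

(** At alpha = 2 the margin 4 / alpha - 2 vanishes, and the decay of the truncated mean of
    a centred variable takes its place. *)
Lemma norm_small_eq2 : alpha = 2 -> (\int[P]_w (Z0 w)%:E = 0)%E -> exists delta s : R,
  [/\ 0 < delta < 2^-1, alpha < s & norm_small P Z0 delta s].
Proof.
move=> a2 E0; pose r : R := 49 / 25.
have rr : 0 < r < alpha by rewrite a2 /r; apply/andP; split; lra.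
have [C C1 HC] := truncated_moment mZ tailP rr.
have r1 : 1 <= r by rewrite /r; lra.
have [C' C1' HC'] := mean_trunc_centered mZ tailP r1 rr E0.
have [D D0 HD] := tailP rr.
exists 10^-1, (100 / 49); split.
- by apply/andP; split; lra.
- by rewrite a2; lra.
apply: (@norm_small_frobenius _ _ _ _ _ mZ r (1 - r) (13 / 25) 10^-1 (100 / 49) D (C + C')) => //.
- by rewrite /r; lra.
- by rewrite /r; lra.
- by rewrite /r; lra.
- move=> b b1; apply: le_trans (mean_trunc_sq _ HC b1) _.
    by rewrite /r; apply/andP; split; lra.
  by rewrite ler_wpM2r ?powR_ge0//; lra.
- move=> b b1; apply: le_trans (HC' b b1) _.
  by rewrite ler_wpM2r ?powR_ge0//; lra.
Qed.

(** At the limiting values r = s = alpha and delta = 0 the conditions of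
    [norm_small_split] read 2 < alpha, 1/2 < 2 / alpha and 2 - alpha / 4 < 4 / alpha, and
    the margin in the last one is (4 - alpha)^2 / (4 alpha). The perturbation eta is a tenth of the
    smallest margin. *)
Lemma norm_small_gt2 : 2 < alpha -> alpha < 4 -> (\int[P]_w (Z0 w)%:E = 0)%E ->
  exists delta s : R, [/\ 0 < delta < 2^-1, alpha < s & norm_small P Z0 delta s].
Proof.
move=> a2 a4 E0; have a0 := alpha0; pose v : R := alpha^-1.
have v0 : 0 < v by rewrite invr_gt0.
have av : alpha * v = 1 by rewrite mulfV// gt_eqF.
have v2 : v < 2^-1 by rewrite ltf_pV2 ?posrE.
have v4 : 4^-1 < v by rewrite ltf_pV2 ?posrE.
have g0 : 0 < 4 * v - 2 + alpha / 4.
  have -> : 4 * v - 2 + alpha / 4 = (4 - alpha) ^+ 2 * v / 4.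
    rewrite (_ : (4 - alpha) ^+ 2 * v = 16 * v - 8 * (alpha * v) + alpha * (alpha * v)); last by ring.
    by rewrite av; field.
  by rewrite divr_gt0// mulr_gt0// exprn_gt0//; lra.
pose M : R := Num.min (alpha - 2) (Num.min (2 * v - 2^-1) (4 * v - 2 + alpha / 4)).
have M0 : 0 < M by rewrite !lt_min g0 andbT; apply/andP; split; lra.
have M1 : M <= alpha - 2 by rewrite ge_min lexx.
have M2 : M <= 2 * v - 2^-1 by rewrite !ge_min lexx orbT.
have M3 : M <= 4 * v - 2 + alpha / 4 by rewrite !ge_min lexx !orbT.
pose eta : R := M / 10; have e0 : 0 < eta by rewrite divr_gt0.
have eM : 10 * eta = M by rewrite /eta; field.
pose r : R := alpha - eta; pose s : R := (v - eta)^-1.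
have r2 : 2 < r by rewrite /r; lra.
have rr : 0 < r < alpha by apply/andP; split; rewrite /r; lra.
have [C C1 HC] := truncated_moment mZ tailP rr.
have r1 : 1 <= r by lra.
have [C' C1' HC'] := mean_trunc_centered mZ tailP r1 rr E0.
have [D D0 HD] := tailP rr.
exists eta, s; split.
- by rewrite e0/=; lra.
- have -> : alpha = v^-1 by rewrite /v invrK.
  by rewrite /s ltf_pV2 ?posrE; lra.
apply: (@norm_small_split _ _ _ _ _ mZ r eta s D (C + C')) => //.
- by rewrite /s invrK; lra.
- by rewrite /s invrK /r; lra.
- by lra.
- by move=> b b0; apply: le_trans (HC b b0) _; lra.
- move=> b b1; apply: le_trans (HC' b b1) _.
  by rewrite ler_wpM2r ?powR_ge0//; lra.
Qed.

End Exponents.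

(** * Convergence in probability *)

Lemma spectral_norm_ge0 {R : realType} m n (A : 'M[R]_(m, n)) : 0 <= spectral_norm A.
Proof.
rewrite /spectral_norm; have [[[s Ss] hub]|nsup] := pselect (has_sup (singular_values A)).
  by apply: le_trans (ub_le_sup hub Ss); case: Ss.
by rewrite sup_out.
Qed.

Section Convergence.
Context {d : measure_display} {T : measurableType d} {R : realType}.
Variable P : probability T R.
Variable Z0 : T -> R.
Hypothesis mZ : measurable_fun setT Z0.

Lemma cvg_norm_small (delta s : R) (rws cls : nat -> nat)
    (X : forall n, 'I_(rws n) -> 'I_(cls n) -> T -> R) (a : nat -> R) :
  norm_small P Z0 delta s -> (forall n, iid_array P Z0 (X n)) ->
  (forall A : R, \forall n \near \oo, A <= (rws n)%:R * (cls n)%:R) ->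
  (\forall n \near \oo, (rws n)%:R <= ((rws n)%:R * (cls n)%:R) `^ (2^-1 + delta) :> R) ->
  (\forall n \near \oo, ((rws n)%:R * (cls n)%:R) `^ s^-1 <= a n) ->
  cvg_in_probability P (fun n w => a n ^- 2 *
    spectral_norm (off_gram (fun i t => X n i t w) (fun i t => X n i t w))) (fun=> 0).
Proof.
move=> small iidX xoo rowsx xa e e0.
pose x n : R := (rws n)%:R * (cls n)%:R.
pose B n := [set w | e * a n ^+ 2 < spectral_norm (off_gram (fun i t => X n i t w) (fun i t => X n i t w))].
have mB n : measurable (B n).
  by apply: (measurable_norm_off_gram (iidX n)); rewrite mulr_ge0 ?sqr_ge0// ltW.
have BE : \forall n \near \oo,
    [set w | e < `|a n ^- 2 * spectral_norm (off_gram (fun i t => X n i t w) (fun i t => X n i t w)) - 0|] = B n.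
  near=> n.
  have xn : 1 <= x n by near: n; exact: xoo.
  have an : 0 < a n.
    apply: (@lt_le_trans _ _ (x n `^ s^-1)); last by near: n.
    by rewrite powR_gt0// (lt_le_trans _ xn).
  by apply/seteqP; split => w /=; rewrite subr0 normrM gtr0_norm ?invr_gt0 ?exprn_gt0//
    ltr_pdivlMl ?exprn_gt0// mulrC ger0_norm// spectral_norm_ge0.
apply/fine_cvgP; split.
  near=> n; have -> := near BE n; last by [].
  by apply: fin_num_measure; exact: mB.
apply/cvgrPdist_le => eps eps0.
have [X0 HX0] := small e eps e0 eps0.
near=> n; rewrite sub0r normrN /= (near BE n)//.
rewrite ger0_norm ?fine_ge0//.
have xn : X0 <= x n by near: n; exact: xoo.
have xn1 : 1 <= x n by near: n; exact: xoo.
have xn0 : 0 < x n by exact: lt_le_trans xn1.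
apply: (HX0 _ _ _ _ (iidX n) xn); first by near: n.
rewrite ler_pM2l// (_ : 2 / s = s^-1 * 2%:R); last by rewrite mulrC.
rewrite -powR_exprn lerXn2r ?nnegrE ?powR_ge0//.
  by apply: (@le_trans _ _ (x n `^ s^-1)); [exact: powR_ge0|near: n].
by near: n.
Unshelve. all: by end_near. Qed.

End Convergence.

(** * Shape of the array *)

Section Dimensions.
Context {R : realType}.

(** Compares exponents: z = z^(1/2 - delta) z^(1/2 + delta), and the first factor is at most
    y^((1 + delta) (1/2 - delta)), where (1 + delta) (1/2 - delta) <= 1/2 + delta. *)
Lemma half_power_le (y z delta : R) : 1 <= y -> 1 <= z -> 0 < delta < 2^-1 ->
  z <= y `^ (1 + delta) -> z <= (y * z) `^ (2^-1 + delta).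
Proof.
move=> y1 z1 /andP[d0 d1] zy.
have y0 : 0 < y by exact: lt_le_trans y1.
have z0 : 0 < z by exact: lt_le_trans z1.
rewrite powRM ?(ltW y0) ?(ltW z0)//.
have {1}-> : z = z `^ (2^-1 - delta) * z `^ (2^-1 + delta).
  by rewrite -powRD_gt0// (_ : _ + _ = 1) ?powRr1 ?(ltW z0)//; field.
rewrite ler_wpM2r ?powR_ge0//.
apply: (@le_trans _ _ ((y `^ (1 + delta)) `^ (2^-1 - delta))).
  apply: ge0_ler_powR; rewrite ?nnegrE ?powR_ge0 ?(ltW z0)//; lra.
rewrite -powRrM; apply: ler_powR => //; nra.
Qed.

Variables (beta : R) (p : nat -> nat) (ell : R -> R).
Hypothesis hell : slowly_varying ell.
Hypothesis hp : forall n : nat, (1 <= n)%N -> (p n)%:R = n%:R `^ beta * ell n%:R.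

Lemma dimension_pos : \forall n \near \oo, (1 <= p n)%N.
Proof.
have [[x0 [ell0 _]] _] := hell.
near=> n; have n1 : (1 <= n)%N by near: n; exact: nbhs_infty_ge.
rewrite -(ltr0n R) hp// mulr_gt0 ?powR_gt0 ?ltr0n//.
by apply: ell0; near: n; exact: nbhs_infty_ger.
Unshelve. all: by end_near. Qed.

Lemma dimension_le (delta : R) : beta <= 1 -> 0 < delta < 2^-1 ->
  \forall n \near \oo, (p n)%:R <= ((p n)%:R * n%:R) `^ (2^-1 + delta) :> R.
Proof.
move=> b1 dd; have d0 : 0 < delta by case/andP: dd.
near=> n; have n1 : (1 <= n)%N by near: n; exact: nbhs_infty_ge.
have p1 : (1 <= p n)%N by near: n; exact: dimension_pos.
have n0 : 0 < n%:R :> R by rewrite ltr0n.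
rewrite mulrC; apply: half_power_le; rewrite ?ler1n//.
have /andP[_ el] : n%:R `^ (- delta) <= ell n%:R <= n%:R `^ delta.
  by near: n; exact: sv_power_bounds.
rewrite hp// powRD_gt0//; apply: ler_pM; rewrite ?powR_ge0//.
  by rewrite -(pmulr_rge0 _ (powR_gt0 beta n0)) -hp.
by apply: ler_powR => //; rewrite ler1n.
Unshelve. all: by end_near. Qed.

Lemma dimension_ge (delta : R) : 1 <= beta -> 0 < delta < 2^-1 ->
  \forall n \near \oo, n%:R <= (n%:R * (p n)%:R) `^ (2^-1 + delta) :> R.
Proof.
move=> b1 dd; have d0 : 0 < delta by case/andP: dd.
(* Chosen so that (1 - d') (1 + delta) = 1: a lower bound p >= n^(1 - d') becomes
   n <= p^(1 + delta). *)
pose d' := delta / (1 + delta).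
have d1 : 0 < 1 + delta by lra.
have d'0 : 0 < d' by rewrite divr_gt0.
near=> n; have n1 : (1 <= n)%N by near: n; exact: nbhs_infty_ge.
have p1 : (1 <= p n)%N by near: n; exact: dimension_pos.
have n0 : 0 < n%:R :> R by rewrite ltr0n.
rewrite mulrC; apply: half_power_le; rewrite ?ler1n//.
have /andP[el _] : n%:R `^ (- d') <= ell n%:R <= n%:R `^ d'.
  by near: n; exact: sv_power_bounds.
have np : n%:R `^ (1 - d') <= (p n)%:R.
  rewrite hp// powRD_gt0//; apply: ler_pM; rewrite ?powR_ge0//.
  by apply: ler_powR => //; rewrite ler1n.
apply: (@le_trans _ _ ((n%:R `^ (1 - d')) `^ (1 + delta))).
  rewrite -powRrM (_ : (1 - d') * (1 + delta) = 1) ?powRr1//.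
  by rewrite /d'; field; rewrite gt_eqF.
by apply: ge0_ler_powR; rewrite ?nnegrE ?powR_ge0 ?(ltW d1).
Unshelve. all: by end_near. Qed.

End Dimensions.

Lemma cvg_in_probability_eq {R : realType} {d : measure_display} {T : measurableType d}
    (P : probability T R) (X Y : nat -> T -> R) (Z : T -> R) :
  (forall n w, Y n w = X n w) -> cvg_in_probability P X Z -> cvg_in_probability P Y Z.
Proof. by move=> XY; have -> : Y = X by apply/funext => n; apply/funext => w. Qed.

(** * Convergence of the normalized off-diagonal part *)

Lemma gram_off_diag {R : realType} {T : Type} m n (X : 'I_m -> 'I_n -> T -> R) w :
  let Zn := sample_mx X w in
  Zn *m Zn^T - diag_part (Zn *m Zn^T) =
  off_gram (fun i t => X i t w) (fun i t => X i t w).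
Proof.
move=> Zn; apply/matrixP => i j; rewrite !mxE.
have E k : \sum_t Zn i t * Zn^T t k = \sum_t X i t w * X k t w.
  by apply: eq_bigr => t _; rewrite !mxE.
by rewrite !E; case: eqP => [<-|_]; rewrite ?mulr1n ?mulr0n ?subrr ?subr0.
Qed.

Lemma sample_mx_tr {R : realType} {T : Type} m n (X : 'I_m -> 'I_n -> T -> R) w :
  (sample_mx X w)^T = sample_mx (fun t i => X i t) w.
Proof. by apply/matrixP => i j; rewrite !mxE. Qed.

Theorem theorem3p5 (R : realType) (d : measure_display)
    (T : measurableType d) (P : probability T R)
    (alpha beta : R) (halpha0 : 0 < alpha) (halpha4 : alpha < 4)
    (hbeta : 0 <= beta)
    (p : nat -> nat)
    (Z0 : {RV P >-> R})
    (Z : forall n : nat, 'I_(p n) -> 'I_n -> {RV P >-> R})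
    (hident : forall (n : nat) (i : 'I_(p n)) (t : 'I_n),
        same_law P P (Z n i t) Z0)
    (hindep : forall n : nat,
        mutually_independent P
          (fun k : 'I_(p n) * 'I_n => Z n k.1 k.2 : T -> R))
    (pplus pminus : R) (L : R -> R)
    (hpplus : 0 <= pplus) (hpminus : 0 <= pminus)
    (hpsum : pplus + pminus = 1)
    (hL : slowly_varying L)
    (htail : tail_balance P Z0 alpha pplus pminus L)
    (hmean : 2 <= alpha -> ('E_P[Z0] = 0)%E)
    (ell : R -> R) (hell : slowly_varying ell)
    (hp : forall n : nat, (1 <= n)%N ->
        (p n)%:R = n%:R `^ beta * ell n%:R)
    (hell0 : beta = 0 -> ell n%:R @[n --> \oo] --> +oo)
    (a : nat -> R) (ha : normalizing_sequence P Z0 a) :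
  (beta <= 1 ->
     cvg_in_probability P
       (fun n w =>
          let Zn := sample_mx (Z n) w in
          (a (n * p n)%N) ^- 2 *
          spectral_norm (Zn *m Zn^T - diag_part (Zn *m Zn^T)))
       (fun=> 0))
  /\
  (1 <= beta ->
     cvg_in_probability P
       (fun n w =>
          let Zn := sample_mx (Z n) w in
          (a (n * p n)%N) ^- 2 *
          spectral_norm (Zn^T *m Zn - diag_part (Zn^T *m Zn)))
       (fun=> 0)).
Proof.
have mZ : measurable_fun setT Z0 by [].
have tailP := tail_le mZ hpsum hL htail.
have [delta [s [dd as_ small]]] : exists delta s : R,
    [/\ 0 < delta < 2^-1, alpha < s & norm_small P Z0 delta s].
  have E0 : 2 <= alpha -> (\int[P]_w (Z0 w)%:E = 0)%E.
    by move=> /hmean; rewrite unlock.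
  have [a2|a2|a2] := ltgtP alpha 2.
  - exact: norm_small_lt2 tailP a2.
  - exact: norm_small_gt2 tailP a2 halpha4 (E0 (ltW a2)).
  - have e2 : 2 <= alpha by rewrite a2.
    exact: norm_small_eq2 tailP a2 (E0 e2).
pose X n (i : 'I_(p n)) (t : 'I_n) : T -> R := Z n i t.
have iidX n : iid_array P Z0 (X n).
  by apply: iid_array_indep => [//|i t|i t|]; [rewrite /X|exact: hident|exact: hindep].
have p1 := dimension_pos hell hp.
have npoo (A : R) : \forall n \near \oo, A <= n%:R * (p n)%:R.
  near=> n; have pn : (1 <= p n)%N by near: n.
  apply: (@le_trans _ _ n%:R); first by near: n; exact: nbhs_infty_ger.
  by rewrite ler_peMr// ler1n.
have [K _ HK] := normalizing_ge mZ halpha0 hpsum hL htail as_ ha.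
have npa : \forall n \near \oo, (n%:R * (p n)%:R) `^ s^-1 <= a (n * p n)%N.
  near=> n; rewrite -natrM; apply: HK => /=.
  by rewrite -(ler_nat R) natrM; near: n; exact: npoo.
split=> hb.
- have H : cvg_in_probability P (fun n w => a (n * p n)%N ^- 2 *
      spectral_norm (off_gram (fun i t => X n i t w) (fun i t => X n i t w))) (fun=> 0).
    apply: (cvg_norm_small small iidX).
    + by move=> A; near=> n; rewrite mulrC; near: n; exact: npoo.
    + have H := dimension_le hell hp hb dd.
      by apply: filterS H => n.
    + by near=> n; rewrite mulrC; near: n; exact: npa.
  apply: cvg_in_probability_eq H => n w; congr (_ * spectral_norm _).
  exact: (gram_off_diag (X n)).
- have H : cvg_in_probability P (fun n w => a (n * p n)%N ^- 2 *
      spectral_norm (off_gram (fun t i => X n i t w) (fun t i => X n i t w))) (fun=> 0).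
    apply: (cvg_norm_small small (fun n => iid_array_tr (iidX n))) => //.
    have H := dimension_ge hell hp hb dd.
    by apply: filterS H => n.
  apply: cvg_in_probability_eq H => n w; congr (_ * spectral_norm _).
  have /= := gram_off_diag (fun t i => X n i t) w.
  by rewrite -(sample_mx_tr (X n)) trmxK.
Unshelve. all: by end_near. Qed.
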